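(* Let $\lambda>0$. For each $X_0\in C^1(\mathbb S,\mathbb R^2)$ there exists a unique $X\in C^1([0,\infty),C^1(\mathbb S,\mathbb R^2))$ such that $X(0)=X_0$ and $X$ satisfies $\partial_tX=F_\lambda(X)$.
   Context: $\mathbb S=[0,1]/\{0\sim 1\}$ is the circle; $C^1(\mathbb S,\mathbb R^2)$ carries its usual Banach norm. Length: $\mathcal L(\gamma)=\int_0^1|\gamma'(u)|\,du$. For $\lambda>0$, $\mathcal G^\lambda:\mathbb S\to\mathbb R$ is the 1-periodic extension of $$\mathcal G^\lambda(x)=-\frac{\cosh\left(\frac{|x|-1/2}{\lambda}\right)}{2\lambda\sinh\left(\frac1{2\lambda}\right)},\qquad x\in[0,1].$$ For $\mathcal L(\gamma)>0$ set $\rho_\gamma(u)=\frac1{\mathcal L(\gamma)}\int_0^u|\gamma'(\tau)|\,d\tau$ and $$(\gamma*_\gamma\mathcal G^\lambda)(u)=\int_0^1\gamma(v)\,\mathcal G^\lambda(\rho_\gamma(v)-\rho_\gamma(u))\,\frac{|\gamma'(v)|}{\mathcal L(\gamma)}\,dv .$$ Define $F_\lambda(\gamma)=-\frac{1}{\lambda^2}\left(\gamma+\gamma*_\gamma\mathcal G^\lambda\right)$ if $\mathcal L(\gamma)\ne0$ and $F_\lambda(\gamma)=0$ if $\mathcal L(\gamma)=0$. The equation is understood as an ODE for curves $t\mapsto X(t)=X(\cdot,t)$ in $C^1(\mathbb S,\mathbb R^2)$. *)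

(* Defs.v *)
From Stdlib Require Import Reals Lra Lia ZArith ProofIrrelevance FunctionalExtensionality.
From Coquelicot Require Import Coquelicot.
Open Scope R_scope.

(* Plane vectors are pairs; Coquelicot's [norm] on [R * R] is the Euclidean
   norm  sqrt (|x|^2 + |y|^2). Derivatives and integrals are taken
   componentwise. *)
Definition plane : Type := (R * R)%type.

Definition enorm (p : plane) : R := norm p.

Definition vDerive (f : R -> plane) (u : R) : plane :=
  (Derive (fun x => fst (f x)) u, Derive (fun x => snd (f x)) u).

Definition vRInt (f : R -> plane) (a b : R) : plane :=
  (RInt (fun x => fst (f x)) a b, RInt (fun x => snd (f x)) a b).

(* Functions on the circle are 1-periodic functions on R. *)
Definition C1_periodic (f : R -> plane) : Prop :=
  (forall u, f (u + 1) = f u) /\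
  (forall u, ex_derive (fun x => fst (f x)) u /\
             ex_derive (fun x => snd (f x)) u) /\
  (forall u, continuous (vDerive f) u).

Record C1S : Type := mkC1S { curve :> R -> plane; curve_C1 : C1_periodic curve }.

Lemma C1S_ext (f g : C1S) : (forall u, f u = g u) -> f = g.
Proof.
destruct f as [f Hf], g as [g Hg]; simpl; intros H.
assert (E : f = g) by (apply functional_extensionality; exact H).
subst g; f_equal; apply proof_irrelevance.
Qed.

Lemma continuous_pair_iff (f : R -> plane) (u : R) :
  continuous f u <->
  continuous (fun x => fst (f x)) u /\ continuous (fun x => snd (f x)) u.
Proof.
split.
- intros H; split.
  + apply (continuous_comp f fst); [exact H | apply continuous_fst].
  + apply (continuous_comp f snd); [exact H | apply continuous_snd].
- intros [H1 H2].
  apply (continuous_ext (fun x => (fst (f x), snd (f x)))).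
  + intros x; destruct (f x); reflexivity.
  + intros P [eps HP].
    specialize (H1 (fun y => ball (fst (f u)) eps y) (locally_ball _ _)).
    specialize (H2 (fun y => ball (snd (f u)) eps y) (locally_ball _ _)).
    unfold filtermap in *.
    generalize (filter_and _ _ H1 H2); apply filter_imp.
    intros x [A B]; apply HP; split; assumption.
Qed.

Lemma vDerive_plus (f g : R -> plane) (u : R) :
  C1_periodic f -> C1_periodic g ->
  vDerive (fun x => plus (f x) (g x)) u = plus (vDerive f u) (vDerive g u).
Proof.
intros (_ & Hf & _) (_ & Hg & _).
destruct (Hf u), (Hg u); unfold vDerive, plus; simpl; unfold prod_plus; simpl.
f_equal; apply Derive_plus; assumption.
Qed.

Lemma vDerive_scal (c : R) (f : R -> plane) (u : R) :
  vDerive (fun x => scal c (f x)) u = scal c (vDerive f u).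
Proof.
unfold vDerive, scal; simpl; unfold prod_scal; simpl.
f_equal; apply (Derive_scal (fun x => _ (f x))).
Qed.

Lemma C1_plus (f g : R -> plane) :
  C1_periodic f -> C1_periodic g -> C1_periodic (fun x => plus (f x) (g x)).
Proof.
intros Hf Hg; split; [|split].
- intros u; rewrite (proj1 Hf), (proj1 Hg); reflexivity.
- intros u; destruct (proj1 (proj2 Hf) u), (proj1 (proj2 Hg) u).
  split; [apply (ex_derive_plus (fun x => fst (f x)) (fun x => fst (g x)))
         |apply (ex_derive_plus (fun x => snd (f x)) (fun x => snd (g x)))];
  assumption.
- intros u.
  apply (continuous_ext (fun x => plus (vDerive f x) (vDerive g x))).
  + intros x; symmetry; apply vDerive_plus; assumption.
  + assert (A := proj2 (proj2 Hf) u); assert (B := proj2 (proj2 Hg) u).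
    apply continuous_pair_iff in A; apply continuous_pair_iff in B.
    apply continuous_pair_iff; split.
    * apply (continuous_plus (fun x => fst (vDerive f x))
               (fun x => fst (vDerive g x))); tauto.
    * apply (continuous_plus (fun x => snd (vDerive f x))
               (fun x => snd (vDerive g x))); tauto.
Qed.

Lemma C1_scal (c : R) (f : R -> plane) :
  C1_periodic f -> C1_periodic (fun x => scal c (f x)).
Proof.
intros Hf; split; [|split].
- intros u; rewrite (proj1 Hf); reflexivity.
- intros u; destruct (proj1 (proj2 Hf) u).
  split; [apply (ex_derive_scal (fun x => fst (f x)))
         |apply (ex_derive_scal (fun x => snd (f x)))]; assumption.
- intros u.
  apply (continuous_ext (fun x => scal c (vDerive f x))).
  + intros x; symmetry; apply vDerive_scal.
  + assert (A := proj2 (proj2 Hf) u); apply continuous_pair_iff in A.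
    apply continuous_pair_iff; split.
    * apply (continuous_scal_r c (fun x => fst (vDerive f x))); tauto.
    * apply (continuous_scal_r c (fun x => snd (vDerive f x))); tauto.
Qed.

Lemma C1_zero : C1_periodic (fun _ => zero).
Proof.
split; [|split].
- reflexivity.
- intros u; split; apply ex_derive_const.
- intros u; apply (continuous_ext (fun _ => (zero : plane))).
  + intros x; unfold vDerive; rewrite !Derive_const; reflexivity.
  + apply continuous_const.
Qed.

Lemma C1_opp (f : R -> plane) :
  C1_periodic f -> C1_periodic (fun x => opp (f x)).
Proof.
intros Hf.
replace (fun x => opp (f x)) with (fun x => scal (opp one) (f x) : plane).
- apply C1_scal; exact Hf.
- apply functional_extensionality; intros x; apply (scal_opp_one (f x)).
Qed.

Definition C1S_plus (f g : C1S) : C1S :=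
  mkC1S (fun x => plus (f x) (g x)) (C1_plus f g (curve_C1 f) (curve_C1 g)).
Definition C1S_scal (c : R) (f : C1S) : C1S :=
  mkC1S (fun x => scal c (f x)) (C1_scal c f (curve_C1 f)).
Definition C1S_opp (f : C1S) : C1S :=
  mkC1S (fun x => opp (f x)) (C1_opp f (curve_C1 f)).
Definition C1S_zero : C1S := mkC1S (fun _ => zero) C1_zero.

Definition C1S_AbelianMonoid_mixin : AbelianMonoid.mixin_of C1S.
Proof.
refine (AbelianMonoid.Mixin C1S C1S_plus C1S_zero _ _ _);
  intros; apply C1S_ext; intros u; simpl.
- apply plus_comm.
- apply plus_assoc.
- apply plus_zero_r.
Defined.

Canonical C1S_AbelianMonoid : AbelianMonoid :=
  AbelianMonoid.Pack C1S C1S_AbelianMonoid_mixin C1S.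

Definition C1S_AbelianGroup_mixin : AbelianGroup.mixin_of C1S_AbelianMonoid.
Proof.
refine (AbelianGroup.Mixin C1S_AbelianMonoid C1S_opp _).
intros; apply C1S_ext; intros u; simpl; apply (plus_opp_r (x u)).
Defined.

Canonical C1S_AbelianGroup : AbelianGroup :=
  AbelianGroup.Pack C1S
    (AbelianGroup.Class C1S C1S_AbelianMonoid_mixin C1S_AbelianGroup_mixin) C1S.

Definition C1S_ModuleSpace_mixin : ModuleSpace.mixin_of R_Ring C1S_AbelianGroup.
Proof.
refine (ModuleSpace.Mixin R_Ring C1S_AbelianGroup C1S_scal _ _ _ _);
  intros; apply C1S_ext; intros t; simpl.
- apply (scal_assoc (V := prod_ModuleSpace R_Ring R_ModuleSpace R_ModuleSpace)).
- apply (scal_one (V := prod_ModuleSpace R_Ring R_ModuleSpace R_ModuleSpace)).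
- apply (scal_distr_l (V := prod_ModuleSpace R_Ring R_ModuleSpace R_ModuleSpace)).
- apply (scal_distr_r (V := prod_ModuleSpace R_Ring R_ModuleSpace R_ModuleSpace)).
Defined.

Definition C1S_ModuleSpace_class : ModuleSpace.class_of R_Ring C1S :=
  ModuleSpace.Class R_Ring C1S
    (AbelianGroup.class C1S_AbelianGroup) C1S_ModuleSpace_mixin.

Canonical C1S_ModuleSpace : ModuleSpace R_Ring :=
  ModuleSpace.Pack R_Ring C1S C1S_ModuleSpace_class C1S.

Definition sup_norm (f : R -> plane) : R :=
  real (Lub_Rbar (fun r => exists u, 0 <= u <= 1 /\ r = enorm (f u))).

Definition C1_norm (f : C1S) : R := sup_norm f + sup_norm (vDerive f).

Lemma curve_continuous (f : C1S) (u : R) : continuous f u.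
Proof.
apply continuous_pair_iff; destruct (proj1 (proj2 (curve_C1 f)) u).
split; [apply (ex_derive_continuous (fun x => fst (f x)))
       |apply (ex_derive_continuous (fun x => snd (f x)))]; assumption.
Qed.

Lemma vDerive_continuous (f : C1S) (u : R) : continuous (vDerive f) u.
Proof. exact (proj2 (proj2 (curve_C1 f)) u). Qed.

Lemma sup_norm_lub (f : R -> plane) : (forall u, continuous f u) ->
  (forall u, 0 <= u <= 1 -> enorm (f u) <= sup_norm f) /\
  (forall M, (forall u, 0 <= u <= 1 -> enorm (f u) <= M) -> sup_norm f <= M).
Proof.
intros Hf.
assert (Hc : forall u, continuity_pt (fun x => enorm (f x)) u).
{ intros u; apply continuity_pt_filterlim.
  apply (continuous_comp f enorm); [apply Hf|].
  apply (filterlim_norm (f u)). }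
destruct (continuity_ab_maj (fun x => enorm (f x)) 0 1) as [m [Hm Hm01]];
  [lra | intros; apply Hc |].
unfold sup_norm.
assert (E : Lub_Rbar (fun r => exists u, 0 <= u <= 1 /\ r = enorm (f u))
            = Finite (enorm (f m))).
{ apply is_lub_Rbar_unique; split.
  - intros r (u & Hu & ->); simpl; apply Hm; exact Hu.
  - intros b Hb; apply Hb; exists m; split; [exact Hm01 | reflexivity]. }
rewrite E; simpl; split; [exact Hm | intros M HM; apply HM; exact Hm01].
Qed.

Lemma periodic_reduce (f : C1S) (u : R) :
  exists v, 0 <= v <= 1 /\ f u = f v.
Proof.
assert (Hn : forall n x, f (x + INR n) = f x).
{ induction n as [|n IH]; intros x.
  - simpl; rewrite Rplus_0_r; reflexivity.
  - rewrite S_INR, <- Rplus_assoc, (proj1 (curve_C1 f)); apply IH. }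
assert (Hz : forall z x, f (x + IZR z) = f x).
{ intros z x; destruct (Z_le_dec 0 z) as [Hz | Hz].
  - rewrite <- (Z2Nat.id z), <- INR_IZR_INZ by assumption; apply Hn.
  - rewrite <- (Hn (Z.to_nat (- z)) (x + IZR z)), INR_IZR_INZ, Z2Nat.id by lia.
    rewrite opp_IZR; f_equal; lra. }
exists (frac_part u); split.
- destruct (base_fp u); lra.
- rewrite <- (Hz (Int_part u) (frac_part u)); f_equal; unfold frac_part; lra.
Qed.

Lemma sup_norm_ext (f g : R -> plane) :
  (forall u, f u = g u) -> sup_norm f = sup_norm g.
Proof.
intros H; replace g with f; [reflexivity|].
apply functional_extensionality; exact H.
Qed.

Lemma sup_norm_nonneg (f : R -> plane) :
  (forall u, continuous f u) -> 0 <= sup_norm f.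
Proof.
intros Hf; apply Rle_trans with (enorm (f 0)).
- apply norm_ge_0.
- apply (sup_norm_lub f Hf); lra.
Qed.

Lemma C1_norm_triangle (f g : C1S) :
  C1_norm (plus f g) <= C1_norm f + C1_norm g.
Proof.
unfold C1_norm.
assert (A : sup_norm (plus f g) <= sup_norm f + sup_norm g).
{ apply (sup_norm_lub (plus f g) (curve_continuous _)); intros u Hu.
  apply Rle_trans with (1 := norm_triangle (f u) (g u)).
  apply Rplus_le_compat;
    apply (proj1 (sup_norm_lub _ (curve_continuous _)) u Hu). }
assert (B : sup_norm (vDerive (plus f g))
            <= sup_norm (vDerive f) + sup_norm (vDerive g)).
{ apply (sup_norm_lub _ (vDerive_continuous (plus f g))); intros u Hu.
  change (curve (plus f g)) with (fun x => plus (f x) (g x)).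
  rewrite vDerive_plus by apply curve_C1.
  apply Rle_trans with (1 := norm_triangle (vDerive f u) (vDerive g u)).
  apply Rplus_le_compat;
    apply (proj1 (sup_norm_lub _ (vDerive_continuous _)) u Hu). }
lra.
Qed.

Lemma C1_norm_scal (c : R) (f : C1S) :
  C1_norm (scal c f) <= Rabs c * C1_norm f.
Proof.
unfold C1_norm.
assert (A : sup_norm (scal c f) <= Rabs c * sup_norm f).
{ apply (sup_norm_lub (scal c f) (curve_continuous _)); intros u Hu.
  apply Rle_trans with (1 := norm_scal c (f u)).
  apply Rmult_le_compat_l; [apply Rabs_pos|].
  apply (proj1 (sup_norm_lub _ (curve_continuous _)) u Hu). }
assert (B : sup_norm (vDerive (scal c f)) <= Rabs c * sup_norm (vDerive f)).
{ apply (sup_norm_lub _ (vDerive_continuous (scal c f))); intros u Hu.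
  change (curve (scal c f)) with (fun x => scal c (f x)).
  rewrite vDerive_scal.
  apply Rle_trans with (1 := norm_scal c (vDerive f u)).
  apply Rmult_le_compat_l; [apply Rabs_pos|].
  apply (proj1 (sup_norm_lub _ (vDerive_continuous _)) u Hu). }
lra.
Qed.

Lemma C1_norm_eq_zero (f : C1S) : C1_norm f = 0 -> f = zero.
Proof.
intros H; apply C1S_ext; intros u.
destruct (periodic_reduce f u) as (v & Hv & ->).
apply (norm_eq_zero (f v)).
assert (A := proj1 (sup_norm_lub _ (curve_continuous f)) v Hv).
assert (B := norm_ge_0 (f v)).
assert (C := sup_norm_nonneg _ (vDerive_continuous f)).
unfold C1_norm in H; unfold enorm in A; lra.
Qed.

Definition C1S_ball (f : C1S) (e : R) (g : C1S) : Prop :=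
  C1_norm (minus g f) < e.

Definition C1S_UniformSpace_mixin : UniformSpace.mixin_of C1S.
Proof.
refine (UniformSpace.Mixin C1S zero C1S_ball _ _ _); unfold C1S_ball.
- intros f [e He]; simpl.
  replace (minus f f) with (scal 0 (zero : C1S))
    by (rewrite minus_eq_zero; apply (scal_zero_l (V := C1S_ModuleSpace))).
  apply Rle_lt_trans with (1 := C1_norm_scal zero zero).
  change (Rabs zero) with (Rabs 0); rewrite Rabs_R0; lra.
- intros f g e H.
  replace (minus f g) with (scal (opp one) (minus g f)).
  + apply Rle_lt_trans with (1 := C1_norm_scal _ _).
    change (Rabs (opp one)) with (Rabs (- (1))); rewrite Rabs_Ropp, Rabs_R1; lra.
  + rewrite scal_opp_one; apply opp_minus.
- intros f g h e1 e2 H1 H2.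
  replace (minus h f) with (plus (minus h g) (minus g f)).
  + apply Rle_lt_trans with (1 := C1_norm_triangle _ _); lra.
  + symmetry; apply minus_trans.
Defined.

Canonical C1S_UniformSpace : UniformSpace :=
  UniformSpace.Pack C1S C1S_UniformSpace_mixin C1S.

Definition C1S_NormedModuleAux_class : NormedModuleAux.class_of R_AbsRing C1S :=
  NormedModuleAux.Class R_AbsRing C1S
    C1S_ModuleSpace_class C1S_UniformSpace_mixin.

Canonical C1S_NormedModuleAux : NormedModuleAux R_AbsRing :=
  NormedModuleAux.Pack R_AbsRing C1S C1S_NormedModuleAux_class C1S.

Definition C1S_NormedModule_mixin :
  NormedModule.mixin_of R_AbsRing C1S_NormedModuleAux.
Proof.
refine (NormedModule.Mixin R_AbsRing C1S_NormedModuleAux C1_norm 1 _ _ _ _ _).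
- exact C1_norm_triangle.
- exact C1_norm_scal.
- intros f g e H; exact H.
- intros f g e H; rewrite Rmult_1_l; exact H.
- exact C1_norm_eq_zero.
Defined.

Canonical C1S_NormedModule : NormedModule R_AbsRing :=
  NormedModule.Pack R_AbsRing C1S
    (NormedModule.Class R_AbsRing C1S
       C1S_NormedModuleAux_class C1S_NormedModule_mixin) C1S.

(* At [t = 0] this is the right derivative. *)
Definition is_derive_ray {V : NormedModule R_AbsRing}
    (X : R -> V) (t : R) (l : V) : Prop :=
  filterlim (fun s => scal (/ (s - t)) (minus (X s) (X t)))
    (within (fun s => 0 <= s) (locally' t)) (locally l).

Definition continuous_ray {V : NormedModule R_AbsRing}
    (Y : R -> V) (t : R) : Prop :=
  filterlim Y (within (fun s => 0 <= s) (locally t)) (locally (Y t)).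

(* Only the values of [X] and [dX] on [0, oo) matter. *)
Definition C1_ray {V : NormedModule R_AbsRing} (X dX : R -> V) : Prop :=
  forall t, 0 <= t -> is_derive_ray X t (dX t) /\ continuous_ray dX t.

Definition curve_length (g : R -> plane) : R :=
  RInt (fun u => enorm (vDerive g u)) 0 1.

(* [kernel01] is the formula on [0, 1]; [Gker] is its 1-periodic extension. *)
Definition kernel01 (lambda x : R) : R :=
  - (cosh ((Rabs x - 1 / 2) / lambda) / (2 * lambda * sinh (1 / (2 * lambda)))).

Definition Gker (lambda x : R) : R := kernel01 lambda (frac_part x).

Definition rho (g : R -> plane) (u : R) : R :=
  / curve_length g * RInt (fun tau => enorm (vDerive g tau)) 0 u.

Definition convG (lambda : R) (g : R -> plane) (u : R) : plane :=
  vRInt (fun v =>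
    scal (Gker lambda (rho g v - rho g u)
          * (enorm (vDerive g v) / curve_length g)) (g v)) 0 1.

Definition Fvf (lambda : R) (g : R -> plane) (u : R) : plane :=
  if Req_EM_T (curve_length g) 0 then zero
  else scal (- (1 / lambda ^ 2)) (plus (g u) (convG lambda g u)).

(* [Fvf lambda g] is a priori only a function; the equation says that the
   derivative [dX t], taken in C^1(S, R^2), is the function
   [Fvf lambda (X t)]. *)
Definition is_solution (lambda : R) (X0 : C1S) (X : R -> C1S) : Prop :=
  X 0 = X0 /\
  exists dX : R -> C1S, C1_ray X dX /\
    forall t, 0 <= t -> forall u, dX t u = Fvf lambda (X t) u.

(* Main.v *)
Require Import Defs.
From Stdlib Require Import Reals Lra Lia ZArith.
From Stdlib Require Import ClassicalEpsilon FunctionalExtensionality PropExtensionality.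
From Coquelicot Require Import Coquelicot.
Open Scope R_scope.

(** The equation is an ordinary differential equation in a Banach space. The Lipschitz
    constant of its right-hand side is controlled by the ratio of the maximal speed of
    the curve to its length, which is unbounded near constant curves; the point is that
    along solutions this ratio stays below a bound fixed by the initial curve.

    Write [L] for the length of [g], [s = |g'|], and [rho] for normalized arc length.
    Let [K] be the primitive of the kernel on [[0, 1]] with [K 0 = 1/2] and
    [K 1 = - 1/2]. Integrating by parts over one period starting at [u] gives
      [F g u = lambda^-2 * int_u^(u+1) g' v * K (rho v - rho u) dv]
    ([convolution_by_parts]). This form has no kink, and [K] is a combination of two
    exponentials, so everything is expressed through integrals
    [E u = int_u^(u+1) w v * exp (th * (rho v - rho u)) dv], where [w] is a coordinate of
    [g'], with [E' = w * (exp th - 1) - th * (s / L) * E] ([is_derive_expint]). As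
    [|w| <= s], one has [|E| <= C L], and hence two facts.
    - Pointwise, [|(F g)' u| <= C * |g' u|], with [C] depending on [lambda] only
      ([Rabs_coord_vDerive_field_le]).
    - The field is Lipschitz with constant [C * (1 + max s / L)] ([field_lipschitz]).

    By the first fact every solution satisfies, at every [u],
    [exp (- c t) * |X0' u| <= |X' u| <= exp (c t) * |X0' u|] ([speed_growth]). Consequently
    [max s / L] is at most [m t], the initial ratio times [exp (2 c t)]
    ([speed_growth_field]); if [X0] is constant, so is [X], and the field vanishes.

    This suggests replacing [F] by [min (1, m t * L / max s) * F]. The factor tends to [0]
    at the rate at which the Lipschitz constant of [F] grows, so that the
    product is globally Lipschitz with constant [C * (1 + 3 * m t)]
    ([cut_field_lipschitz]). A global Picard theorem then yields a unique global solution
    of the modified equation ([picard_lindelof_global], [C1_ray_unique]). The modified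
    field still satisfies the pointwise bound, so the speed estimates hold for solutions
    of either equation, and along them the factor equals [1]: the two equations have the
    same solutions. *)

(** * Norms and limits in normed modules *)

Lemma minus_plus_l {G : AbelianGroup} (a b : G) : minus (plus a b) a = b.
Proof.
unfold minus; rewrite (plus_comm a), <- plus_assoc.
transitivity (plus b zero); [f_equal; apply plus_opp_r | apply plus_zero_r].
Qed.

Lemma minus_zero {V : NormedModule R_AbsRing} (x : V) : minus x zero = x.
Proof. apply (minus_zero_r (G := NormedModule.AbelianGroup _ V)). Qed.

Lemma minus_self {V : NormedModule R_AbsRing} (x : V) : minus x x = zero.
Proof. apply (minus_eq_zero (G := NormedModule.AbelianGroup _ V)). Qed.

Lemma eq_of_minus_zero {V : NormedModule R_AbsRing} (x y : V) : minus x y = zero -> x = y.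
Proof.
intros E; apply (plus_reg_r (G := NormedModule.AbelianGroup _ V) (opp y)).
transitivity (zero : V); [exact E|].
symmetry; apply (plus_opp_r (G := NormedModule.AbelianGroup _ V)).
Qed.

Lemma norm_minus_sym {V : NormedModule R_AbsRing} (x y : V) :
  norm (minus x y) = norm (minus y x).
Proof. rewrite <- (norm_opp (minus x y)), opp_minus; reflexivity. Qed.

Lemma norm_minus_triangle {V : NormedModule R_AbsRing} (x y z : V) :
  norm (minus x z) <= norm (minus x y) + norm (minus y z).
Proof. rewrite (minus_trans y x z); apply norm_triangle. Qed.

(** The axioms of a normed module give one inequality; over the reals the other one
    comes from scaling back by [/ a]. *)
Lemma norm_scal_eq {V : NormedModule R_AbsRing} (a : R) (x : V) :
  norm (scal a x) = Rabs a * norm x.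
Proof.
apply Rle_antisym; [apply (norm_scal a x)|].
destruct (Req_dec a 0) as [->|Ha].
- rewrite Rabs_R0, Rmult_0_l; apply norm_ge_0.
- replace (norm x) with (norm (scal (/ a) (scal a x))).
  + apply Rle_trans with (Rabs a * (Rabs (/ a) * norm (scal a x))).
    * apply Rmult_le_compat_l; [apply Rabs_pos | apply (norm_scal (/ a))].
    * rewrite <- Rmult_assoc, <- Rabs_mult, Rinv_r, Rabs_R1 by exact Ha; lra.
  + rewrite scal_assoc; change (mult (/ a) a) with (/ a * a).
    rewrite Rinv_l by exact Ha; change 1 with (one : R_Ring); rewrite scal_one; reflexivity.
Qed.

Lemma filterlim_norm_iff {T : Type} {V : NormedModule R_AbsRing}
    (F : (T -> Prop) -> Prop) {FF : Filter F} (f : T -> V) (l : V) :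
  filterlim f F (locally l) <->
  forall eps : R, 0 < eps -> F (fun x => norm (minus (f x) l) < eps).
Proof.
split.
- intros H eps He.
  apply (H (fun y => norm (minus y l) < eps)).
  apply locally_le_locally_norm.
  exists (mkposreal eps He); intros y Hy; exact Hy.
- intros H P HP.
  apply locally_norm_le_locally in HP; destruct HP as [eps HP].
  unfold filtermap; generalize (H eps (cond_pos eps)); apply filter_imp.
  intros x Hx; apply HP; exact Hx.
Qed.

(** * Differentiation on the half-line *)

Lemma is_derive_norm_iff {V : NormedModule R_AbsRing} (X : R -> V) (t : R) (l : V) :
  is_derive X t l <->
  forall eps : posreal, locally t (fun s =>
    norm (minus (minus (X s) (X t)) (scal (s - t) l)) <= eps * Rabs (s - t)).
Proof.
split.
- intros [_ H] eps.
  exact (H t (fun P HP => HP) eps).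
- intros H; split; [apply is_linear_scal_l|].
  intros x Hx eps.
  replace x with t; [exact (H eps)|].
  apply (is_filter_lim_locally_unique (V := R_NormedModule)); exact Hx.
Qed.

Lemma is_derive_ray_norm_iff {V : NormedModule R_AbsRing} (X : R -> V) (t : R) (l : V) :
  is_derive_ray X t l <->
  forall eps : posreal, locally t (fun s => 0 <= s ->
    norm (minus (minus (X s) (X t)) (scal (s - t) l)) <= eps * Rabs (s - t)).
Proof.
assert (Q : forall s, s <> t ->
  norm (minus (minus (X s) (X t)) (scal (s - t) l))
  = Rabs (s - t) * norm (minus (scal (/ (s - t)) (minus (X s) (X t))) l)).
{ intros s Hs.
  rewrite <- norm_scal_eq, scal_minus_distr_l, scal_assoc.
  change (mult (s - t) (/ (s - t))) with ((s - t) * / (s - t)).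
  rewrite Rinv_r by lra.
  change 1 with (one : R_Ring); rewrite scal_one; reflexivity. }
apply (iff_trans (filterlim_norm_iff (within (fun s => 0 <= s) (locally' t))
  (fun s => scal (/ (s - t)) (minus (X s) (X t))) l));
  unfold within, locally'; split.
- intros H eps.
  generalize (H eps (cond_pos eps)); unfold within; apply filter_imp; intros s Hs H0.
  destruct (Req_dec s t) as [->|Hst].
  + replace (minus (minus (X t) (X t)) (scal (t - t) l)) with (zero : V).
    * rewrite norm_zero, Rminus_diag, Rabs_R0; lra.
    * rewrite Rminus_diag, minus_eq_zero.
      change 0 with (zero : R_Ring); rewrite scal_zero_l; symmetry; apply (minus_eq_zero (zero : V)).
  + rewrite Q by exact Hst; rewrite Rmult_comm.
    apply Rmult_le_compat_r; [apply Rabs_pos|].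
    apply Rlt_le, Hs; assumption.
- intros H eps He.
  assert (He2 : 0 < eps / 2) by lra.
  change (locally t (fun s => s <> t -> 0 <= s ->
    norm (minus (scal (/ (s - t)) (minus (X s) (X t))) l) < eps)).
  generalize (H (mkposreal _ He2)); apply filter_imp; intros s Hs Hst H0.
  specialize (Hs H0); rewrite Q in Hs by exact Hst; simpl in Hs.
  assert (0 < Rabs (s - t)) by (apply Rabs_pos_lt; lra).
  rewrite (Rmult_comm (eps / 2)) in Hs.
  apply Rmult_le_reg_l in Hs; lra.
Qed.

Lemma is_derive_is_derive_ray {V : NormedModule R_AbsRing} (X : R -> V) (t : R) (l : V) :
  is_derive X t l -> is_derive_ray X t l.
Proof.
rewrite is_derive_norm_iff, is_derive_ray_norm_iff; intros H eps.
generalize (H eps); apply filter_imp; auto.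
Qed.

Lemma continuous_continuous_ray {V : NormedModule R_AbsRing} (X : R -> V) (t : R) :
  continuous X t -> continuous_ray X t.
Proof. apply filterlim_filter_le_1, filter_le_within. Qed.

(** Continuing along the tangent at [0] turns a one-sided derivative into a
    two-sided one, so that calculus on the line applies to solutions on the ray. *)
Lemma C1_ray_extension {V : NormedModule R_AbsRing} (X dX : R -> V) :
  C1_ray X dX ->
  exists Y dY : R -> V,
    (forall t, 0 <= t -> Y t = X t /\ dY t = dX t) /\
    (forall t, is_derive Y t (dY t)) /\ (forall t, continuous dY t).
Proof.
intros H.
exists (fun t => if Rlt_dec t 0 then plus (X 0) (scal t (dX 0)) else X t),
  (fun t => dX (Rmax t 0)).
split; [|split].
- intros t Ht; destruct (Rlt_dec t 0); [lra|].
  rewrite Rmax_left by lra; auto.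
- intros t; destruct (Rlt_dec t 0) as [Ht|Ht].
  + apply is_derive_ext_loc with (fun s => plus (X 0) (scal s (dX 0))).
    * exists (mkposreal (- t) ltac:(lra)); intros s Hs.
      destruct (Rlt_dec s 0); [reflexivity|].
      apply Rabs_lt_between' in Hs; simpl in Hs; lra.
    * rewrite Rmax_right by lra.
      evar_last.
      -- apply (is_derive_plus (fun _ => X 0) (fun s => scal s (dX 0)));
           [apply (is_derive_const (X 0))|].
         apply (is_derive_scal_l (fun s : R => s) t one (dX 0)), (is_derive_id t).
      -- rewrite plus_zero_l; apply scal_one.
  + destruct (H t ltac:(lra)) as [HX _].
    rewrite Rmax_left by lra.
    apply is_derive_norm_iff; intros eps.
    rewrite is_derive_ray_norm_iff in HX; specialize (HX eps).
    destruct (Rlt_dec t 0) as [?|_]; [lra|].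
    destruct (Req_dec t 0) as [->|Ht0].
    * generalize HX; apply filter_imp; intros s Hs.
      destruct (Rlt_dec s 0) as [Hs0|Hs0]; [|apply Hs; lra].
      rewrite Rminus_0_r.
      replace (minus (minus (plus (X 0) (scal s (dX 0))) (X 0)) (scal s (dX 0)))
        with (zero : V).
      -- rewrite norm_zero; apply Rmult_le_pos;
           [apply Rlt_le, cond_pos | apply Rabs_pos].
      -- replace (minus (plus (X 0) (scal s (dX 0))) (X 0)) with (scal s (dX 0))
           by (symmetry; apply (minus_plus_l (G := NormedModule.AbelianGroup _ V))).
         symmetry; apply (minus_eq_zero (scal s (dX 0))).
    * assert (HT : locally t (fun s => 0 < s)) by (apply (open_gt 0 t); lra).
      generalize (filter_and _ _ HX HT); apply filter_imp; intros s [Hs Hs0].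
      destruct (Rlt_dec s 0); [lra|]; apply Hs; lra.
- intros t.
  destruct (H (Rmax t 0) (Rmax_r _ _)) as [_ HX].
  apply (filterlim_comp _ _ _ (fun s => Rmax s 0) dX (locally t)
    (within (fun s => 0 <= s) (locally (Rmax t 0))) (locally (dX (Rmax t 0))));
    [|exact HX].
  intros P [eps HP]; exists eps; intros s Hs; apply HP; [|apply Rmax_r].
  apply Rabs_lt_between'; apply Rabs_lt_between' in Hs.
  destruct eps as [eps He]; simpl in *; unfold Rmax.
  destruct (Rle_dec s 0), (Rle_dec t 0); lra.
Qed.

(** * Gronwall's inequality and uniqueness *)

Lemma gronwall (g dg : R -> R) (c T : R) :
  (forall t, is_derive g t (dg t)) ->
  (forall t, 0 <= t <= T -> dg t <= c * g t) ->
  forall t, 0 <= t <= T -> g t <= g 0 * exp (c * t).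
Proof.
intros Hd Hle t Ht.
pose (h := fun s => g s * exp (- (c * s))).
assert (Hh : forall s, is_derive h s ((dg s - c * g s) * exp (- (c * s)))).
{ intros s; unfold h; evar_last.
  - apply (is_derive_mult g (fun s => exp (- (c * s))));
      [apply Hd | auto_derive; [trivial | reflexivity] | apply Rmult_comm].
  - unfold plus, mult; simpl; ring. }
destruct (MVT_gen h 0 t (fun s => (dg s - c * g s) * exp (- (c * s)))) as [s [Hs E]].
- intros s _; apply Hh.
- intros s _; apply derivable_continuous_pt.
  exists ((dg s - c * g s) * exp (- (c * s))); apply is_derive_Reals, Hh.
- rewrite Rmin_left, Rmax_right in Hs by lra.
  assert (A := Hle s ltac:(lra)); assert (B := exp_pos (- (c * s))).
  assert (P : 0 <= (c * g s - dg s) * exp (- (c * s)) * t)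
    by (repeat apply Rmult_le_pos; lra).
  assert (Hdec : h t <= h 0) by lra.
  unfold h in Hdec; rewrite Rmult_0_r, Ropp_0, exp_0, Rmult_1_r in Hdec.
  replace (g t) with (g t * exp (- (c * t)) * exp (c * t)).
  + apply Rmult_le_compat_r; [apply Rlt_le, exp_pos | exact Hdec].
  + rewrite Rmult_assoc, <- exp_plus.
    replace (- (c * t) + c * t) with 0 by ring; rewrite exp_0; ring.
Qed.

Lemma continuous_norm {V : NormedModule R_AbsRing} (X : R -> V) (t : R) :
  continuous X t -> continuous (fun s => norm (X s)) t.
Proof.
intros H; apply (continuous_comp X norm); [exact H | apply (filterlim_norm (X t))].
Qed.

Lemma ex_RInt_continuity {V : CompleteNormedModule R_AbsRing} (f : R -> V) (a b : R) :
  (forall t, continuous f t) -> ex_RInt f a b.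
Proof. intros H; apply ex_RInt_continuous; auto. Qed.

Lemma is_derive_RInt_continuity {V : CompleteNormedModule R_AbsRing}
    (f : R -> V) (a t : R) :
  (forall t, continuous f t) -> is_derive (fun t => RInt f a t) t (f t).
Proof.
intros H; apply (is_derive_RInt f (fun t => RInt f a t) a t); [|apply H].
apply filter_forall; intros s; apply RInt_correct, ex_RInt_continuity, H.
Qed.

(** [norm (W t)] need not be differentiable, so Gronwall is applied to its integral. *)
Lemma zero_of_norm_derive_le {V : CompleteNormedModule R_AbsRing}
    (W dW : R -> V) (K T : R) :
  (forall t, is_derive W t (dW t)) -> (forall t, continuous dW t) ->
  W 0 = zero ->
  (forall t, 0 <= t <= T -> norm (dW t) <= K * norm (W t)) ->
  forall t, 0 <= t <= T -> W t = zero.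
Proof.
intros Hd Hc H0 Hle t Ht.
assert (Hcn : forall s, continuous (fun s => norm (W s)) s).
{ intros s; apply continuous_norm, ex_derive_continuous; eexists; apply Hd. }
assert (HK : forall s, 0 <= s <= T -> norm (W s) <= K * RInt (fun s => norm (W s)) 0 s).
{ intros s Hs.
  assert (A := is_RInt_derive W dW 0 s (fun x _ => Hd x) (fun x _ => Hc x)).
  rewrite H0 in A.
  rewrite <- (minus_zero (W s)).
  apply (norm_RInt_le dW (fun x => K * norm (W x)) 0 s _ _ (proj1 Hs)
    (fun x Hx => Hle x ltac:(lra)) A).
  apply (is_RInt_scal (fun x => norm (W x)) 0 s K), (RInt_correct (V := R_CompleteNormedModule)).
  apply (ex_RInt_continuity (V := R_CompleteNormedModule)), Hcn. }
assert (G := gronwall (fun t => RInt (fun s => norm (W s)) 0 t) (fun t => norm (W t)) K T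
  (fun t => is_derive_RInt_continuity (V := R_CompleteNormedModule) _ 0 t Hcn) HK t Ht).
simpl in G; rewrite (RInt_point (V := R_CompleteNormedModule)) in G.
change (@zero _) with 0 in G; rewrite Rmult_0_l in G.
apply (norm_eq_zero (V := CompleteNormedModule.NormedModule _ V)), Rle_antisym; [|apply norm_ge_0].
assert (P : 0 <= RInt (fun s => norm (W s)) 0 t).
{ apply RInt_ge_0; [lra | | intros; apply norm_ge_0].
  apply (ex_RInt_continuity (V := R_CompleteNormedModule)), Hcn. }
replace (RInt (fun s => norm (W s)) 0 t) with 0 in HK by lra.
assert (A := HK t Ht); replace (RInt (fun s => norm (W s)) 0 t) with 0 in A by lra; lra.
Qed.

Lemma C1_ray_unique {V : CompleteNormedModule R_AbsRing} (X Z dX dZ : R -> V) (K T : R) :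
  C1_ray X dX -> C1_ray Z dZ -> X 0 = Z 0 ->
  (forall t, 0 <= t <= T ->
    norm (minus (dX t) (dZ t)) <= K * norm (minus (X t) (Z t))) ->
  forall t, 0 <= t <= T -> X t = Z t.
Proof.
intros HX HZ H0 Hle t Ht.
destruct (C1_ray_extension X dX HX) as (X' & dX' & EX & DX & CX).
destruct (C1_ray_extension Z dZ HZ) as (Z' & dZ' & EZ & DZ & CZ).
assert (E : minus (X' t) (Z' t) = zero).
{ apply (zero_of_norm_derive_le (fun s => minus (X' s) (Z' s))
    (fun s => minus (dX' s) (dZ' s)) K T); [| | | | exact Ht].
  - intros s; apply (is_derive_minus X' Z'); auto.
  - intros s; apply (continuous_minus dX' dZ'); auto.
  - rewrite (proj1 (EX 0 ltac:(lra))), (proj1 (EZ 0 ltac:(lra))), H0.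
    apply (minus_self (Z 0)).
  - intros s Hs; destruct (EX s ltac:(lra)) as [-> ->], (EZ s ltac:(lra)) as [-> ->]; auto. }
rewrite (proj1 (EX t ltac:(lra))), (proj1 (EZ t ltac:(lra))) in E.
apply (eq_of_minus_zero (X t)); exact E.
Qed.

(** * The global Picard theorem *)

Lemma norm_minus_trans_le {V : NormedModule R_AbsRing} (x y z : V) (a b : R) :
  norm (minus x y) <= a -> norm (minus y z) <= b -> norm (minus x z) <= a + b.
Proof. intros Ha Hb; assert (A := norm_minus_triangle x y z); lra. Qed.

Lemma norm_minus_sym_le {V : NormedModule R_AbsRing} (x y : V) (a : R) :
  norm (minus x y) <= a -> norm (minus y x) <= a.
Proof. rewrite norm_minus_sym; trivial. Qed.

Lemma half_pow_small (B eps : R) : 0 < eps -> exists n : nat, B * (1 / 2) ^ n < eps.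
Proof.
intros He.
destruct (pow_lt_1_zero (1 / 2) ltac:(rewrite Rabs_pos_eq; lra) (eps / (Rabs B + 1)))
  as [n Hn].
- apply Rdiv_lt_0_compat; [exact He|]; assert (A := Rabs_pos B); lra.
- exists n; specialize (Hn n (le_n n)).
  assert (P : 0 < (1 / 2) ^ n) by (apply pow_lt; lra).
  rewrite Rabs_pos_eq in Hn by lra.
  assert (A := Rabs_pos B); assert (A' := Rle_abs B).
  apply Rmult_lt_compat_l with (r := Rabs B + 1) in Hn; [|lra].
  replace ((Rabs B + 1) * (eps / (Rabs B + 1))) with eps in Hn by (field; lra).
  assert (B * (1 / 2) ^ n <= Rabs B * (1 / 2) ^ n) by (apply Rmult_le_compat_r; lra).
  lra.
Qed.

Lemma minus_plus_plus {V : CompleteNormedModule R_AbsRing} (c a b : V) :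
  minus (plus c a) (plus c b) = minus a b.
Proof.
apply (plus_reg_r (G := CompleteNormedModule.AbelianGroup _ V) b).
transitivity a.
- transitivity (minus (plus c a) c);
    [|apply (minus_plus_l (G := CompleteNormedModule.AbelianGroup _ V))].
  unfold minus; rewrite <- plus_assoc; f_equal.
  rewrite (opp_plus (G := CompleteNormedModule.AbelianGroup _ V)).
  rewrite <- plus_assoc.
  transitivity (plus (opp c) zero); [|apply plus_zero_r].
  f_equal; apply (plus_opp_l (G := CompleteNormedModule.AbelianGroup _ V)).
- unfold minus; rewrite <- plus_assoc.
  transitivity (plus a zero); [symmetry; apply plus_zero_r|].
  f_equal; symmetry; apply (plus_opp_l (G := CompleteNormedModule.AbelianGroup _ V)).
Qed.

Lemma norm_minus_self {V : NormedModule R_AbsRing} (x : V) : norm (minus x x) = 0.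
Proof. rewrite minus_self; apply norm_zero. Qed.

(** All limits below converge at a geometric rate, and equality of two limits is always
    obtained from this lemma. *)
Lemma eq_of_norm_minus_small {V : NormedModule R_AbsRing} (x y : V) (B : R) :
  (forall n : nat, norm (minus x y) <= B * (1 / 2) ^ n) -> x = y.
Proof.
intros H; apply eq_of_minus_zero, norm_eq_zero, Rle_antisym; [|apply norm_ge_0].
apply le_epsilon; intros eps He.
destruct (half_pow_small B eps He) as [n Hn].
specialize (H n); lra.
Qed.

Lemma Rmax_0_lipschitz (s t : R) : Rabs (Rmax s 0 - Rmax t 0) <= Rabs (s - t).
Proof.
unfold Rmax; destruct (Rle_dec s 0), (Rle_dec t 0); unfold Rabs;
  repeat destruct Rcase_abs; lra.
Qed.

Lemma continuous_Rmax_0 (t : R) : continuous (fun s => Rmax s 0) t.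
Proof.
apply filterlim_locally; intros eps; exists eps; intros s Hs.
apply Rle_lt_trans with (1 := Rmax_0_lipschitz s t), Hs.
Qed.

Lemma exp_le_exp (x y : R) : x <= y -> exp x <= exp y.
Proof.
intros [H| ->]; [apply Rlt_le, exp_increasing, H | apply Rle_refl].
Qed.

Lemma geometric_cauchy_limit {V : CompleteNormedModule R_AbsRing} (u : nat -> V) (B : R) :
  (forall n m, (n <= m)%nat -> norm (minus (u m) (u n)) <= B * (1 / 2) ^ n) ->
  exists l, filterlim u eventually (locally l) /\
    forall n, norm (minus l (u n)) <= B * (1 / 2) ^ n.
Proof.
intros Hu.
destruct (proj1 (filterlim_locally_cauchy (F := eventually) u)) as [l Hl].
- intros eps.
  destruct (half_pow_small B (eps / 2) ltac:(destruct eps; simpl; lra)) as [N HN].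
  exists (fun n => (N <= n)%nat); split; [exists N; auto|].
  intros n m Hn Hm; apply (norm_compat1 (u n) (u m) eps).
  apply Rle_lt_trans with (1 := norm_minus_trans_le _ _ _ _ _ (Hu N m Hm)
    (norm_minus_sym_le _ _ _ (Hu N n Hn))); lra.
- exists l; split; [exact Hl|]; intros n.
  apply le_epsilon; intros eps He.
  destruct (proj1 (filterlim_norm_iff eventually _ _) Hl eps He) as [N HN].
  assert (A := Rlt_le _ _ (HN (max n N) ltac:(lia))).
  apply Rle_trans with (1 := norm_minus_trans_le _ _ _ _ _ (norm_minus_sym_le _ _ _ A)
    (Hu n (max n N) ltac:(lia))).
  lra.
Qed.

Lemma norm_RInt_le_bound {V : CompleteNormedModule R_AbsRing} (f : R -> V) (g : R -> R)
    (t b : R) :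
  0 <= t -> (forall s, continuous f s) -> (forall s, continuous g s) ->
  (forall s, 0 <= s <= t -> norm (f s) <= g s) ->
  RInt g 0 t <= b -> norm (RInt f 0 t) <= b.
Proof.
intros Ht Hf Hg Hle Hb; apply Rle_trans with (2 := Hb).
apply (norm_RInt_le f g 0 t); [exact Ht | exact Hle | |].
- apply RInt_correct, ex_RInt_continuity, Hf.
- apply (RInt_correct (V := R_CompleteNormedModule)).
  apply (ex_RInt_continuity (V := R_CompleteNormedModule)), Hg.
Qed.

Fixpoint picard_iterate {V : CompleteNormedModule R_AbsRing} (f : R -> V -> V) (x0 : V)
    (n : nat) : R -> V :=
  match n with
  | O => fun _ => x0
  | S n => fun t => plus x0 (RInt (fun s => f s (picard_iterate f x0 n s)) 0 t)
  end.

Section Picard.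
Context {V : CompleteNormedModule R_AbsRing} (f : R -> V -> V) (x0 : V).
Hypothesis Hcont : forall X : R -> V, (forall t, continuous X t) ->
  forall t, continuous (fun s => f s (X s)) t.

Let P := picard_iterate f x0.

Lemma picard_iterate_continuous (n : nat) (t : R) : continuous (P n) t.
Proof.
revert t; induction n as [|n IH]; intros t; simpl.
- apply continuous_const.
- apply (continuous_plus (fun _ => x0)); [apply continuous_const|].
  apply ex_derive_continuous; eexists.
  apply (is_derive_RInt_continuity (fun s => f s (P n s)) 0 t).
  intros s; apply Hcont, IH.
Qed.

Lemma picard_minus (X Y : R -> V) (t : R) :
  (forall t, continuous X t) -> (forall t, continuous Y t) ->
  minus (plus x0 (RInt (fun s => f s (X s)) 0 t)) (plus x0 (RInt (fun s => f s (Y s)) 0 t))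
  = RInt (fun s => minus (f s (X s)) (f s (Y s))) 0 t.
Proof.
intros HX HY.
rewrite minus_plus_plus; symmetry.
apply (RInt_minus (fun s => f s (X s)) (fun s => f s (Y s)));
  apply ex_RInt_continuity, Hcont; assumption.
Qed.

(** In the norm weighted by [exp (- 2 K t)] the Picard map contracts with ratio
    [1/2], since [K * int_0^t exp (2 K s) ds <= exp (2 K t) / 2], whatever the length of
    the time interval. This is why the solution is global. *)
Lemma picard_step (K T B : R) (X Y : R -> V) (t : R) :
  0 < K -> 0 <= B ->
  (forall s x y, s <= T -> norm (minus (f s x) (f s y)) <= K * norm (minus x y)) ->
  (forall t, continuous X t) -> (forall t, continuous Y t) ->
  (forall s, 0 <= s <= T -> norm (minus (X s) (Y s)) <= B * exp (2 * K * s)) ->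
  0 <= t <= T ->
  norm (minus (plus x0 (RInt (fun s => f s (X s)) 0 t))
              (plus x0 (RInt (fun s => f s (Y s)) 0 t)))
  <= B * (1 / 2) * exp (2 * K * t).
Proof.
intros HK HB HL HX HY Hle Ht.
rewrite picard_minus by assumption.
apply (norm_RInt_le_bound _ (fun s => K * (B * exp (2 * K * s)))).
- lra.
- intros s; apply (continuous_minus (fun s => f s (X s)) (fun s => f s (Y s)));
    apply Hcont; assumption.
- intros s; apply (ex_derive_continuous (fun s => K * (B * exp (2 * K * s)))).
  auto_derive; trivial.
- intros s Hs; apply Rle_trans with (1 := HL s _ _ ltac:(lra)).
  apply Rmult_le_compat_l; [lra|]; apply Hle; lra.
- rewrite (is_RInt_unique (V := R_CompleteNormedModule) _ _ _
    (minus (B * (1 / 2) * exp (2 * K * t)) (B * (1 / 2) * exp (2 * K * 0)))).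
  + change (B * (1 / 2) * exp (2 * K * t) - B * (1 / 2) * exp (2 * K * 0)
      <= B * (1 / 2) * exp (2 * K * t)).
    assert (A := exp_pos (2 * K * 0)); nra.
  + apply (is_RInt_derive (V := R_CompleteNormedModule)
      (fun s => B * (1 / 2) * exp (2 * K * s))).
    * intros s _; auto_derive; [trivial | field].
    * intros s _; apply (ex_derive_continuous (fun s => K * (B * exp (2 * K * s)))).
      auto_derive; trivial.
Qed.

Hypothesis Hlip : forall T, exists K, 0 < K /\ forall t x y, t <= T ->
  norm (minus (f t x) (f t y)) <= K * norm (minus x y).

Lemma continuous_bounded_norm (X : R -> V) (T : R) : 0 <= T ->
  (forall t, continuous X t) ->
  exists B, 0 <= B /\ forall t, 0 <= t <= T -> norm (X t) <= B.
Proof.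
intros HT HX.
destruct (continuity_ab_maj (fun t => norm (X t)) 0 T HT) as [m [Hm _]].
- intros t _; apply continuity_pt_filterlim, continuous_norm, HX.
- exists (norm (X m)); split; [apply norm_ge_0 | exact Hm].
Qed.

Lemma picard_iterate_cauchy (T : R) : 0 <= T ->
  exists B, 0 <= B /\ forall n m t, (n <= m)%nat -> 0 <= t <= T ->
    norm (minus (P m t) (P n t)) <= B * (1 / 2) ^ n.
Proof.
intros HT; destruct (Hlip T) as (K & HK & HL).
destruct (continuous_bounded_norm (fun t => minus (P 1%nat t) (P O t)) T HT) as (A & HA & HAb).
{ intros t; apply (continuous_minus (P 1%nat) (P O)); apply picard_iterate_continuous. }
assert (Hstep : forall n t, 0 <= t <= T ->
  norm (minus (P (S n) t) (P n t)) <= A * (1 / 2) ^ n * exp (2 * K * t)).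
{ induction n as [|n IH]; intros t Ht.
  - simpl pow; apply Rle_trans with (1 := HAb t Ht).
    assert (1 <= exp (2 * K * t)) by (rewrite <- exp_0; apply exp_le_exp; nra); nra.
  - replace (A * (1 / 2) ^ S n) with (A * (1 / 2) ^ n * (1 / 2)) by (simpl; ring).
    apply (picard_step K T (A * (1 / 2) ^ n) (P (S n)) (P n) t HK); try assumption.
    + apply Rmult_le_pos; [exact HA | apply pow_le; lra].
    + apply picard_iterate_continuous.
    + apply picard_iterate_continuous. }
set (E := exp (2 * K * T)).
assert (HE : 0 < E) by apply exp_pos.
exists (2 * A * E); split; [nra|].
intros n m t Hnm Ht.
assert (Q : norm (minus (P m t) (P n t)) <= 2 * A * E * ((1 / 2) ^ n - (1 / 2) ^ m)).
{ induction Hnm as [|m Hnm IH].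
  - apply Rle_trans with 0; [|lra].
    apply Req_le, (norm_minus_self (V := CompleteNormedModule.NormedModule _ V)).
  - apply Rle_trans with (1 := norm_minus_triangle _ (P m t) _).
    assert (B := Hstep m t Ht).
    assert (D : exp (2 * K * t) <= E) by (apply exp_le_exp; nra).
    assert (F : 0 <= A * (1 / 2) ^ m) by (apply Rmult_le_pos; [exact HA | apply pow_le; lra]).
    assert (G : A * (1 / 2) ^ m * exp (2 * K * t) <= A * (1 / 2) ^ m * E)
      by (apply Rmult_le_compat_l; assumption).
    apply Rle_trans with (1 := Rplus_le_compat _ _ _ _ B IH); simpl pow; lra. }
assert (0 < (1 / 2) ^ m) by (apply pow_lt; lra).
assert (0 <= A * E) by nra.
nra.
Qed.

(** The rate depends on the horizon [T], but the limit does not: it is chosen pointwise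
    in [t]. *)
Lemma picard_limit : exists X : R -> V,
  forall T, 0 <= T -> exists B, 0 <= B /\ forall n t, 0 <= t <= T ->
    norm (minus (X t) (P n t)) <= B * (1 / 2) ^ n.
Proof.
assert (H : forall t, exists l, 0 <= t -> filterlim (fun n => P n t) eventually (locally l)).
{ intros t; destruct (Rle_dec 0 t) as [Ht|Ht]; [|exists zero; lra].
  destruct (picard_iterate_cauchy t Ht) as (B & _ & HB).
  destruct (geometric_cauchy_limit (fun n => P n t) B) as (l & Hl & _).
  - intros n m Hnm; apply HB; [exact Hnm | lra].
  - exists l; auto. }
exists (fun t => proj1_sig (constructive_indefinite_description _ (H t))).
intros T HT; destruct (picard_iterate_cauchy T HT) as (B & HB & HBb).
exists B; split; [exact HB|]; intros n t Ht.
destruct (constructive_indefinite_description _ (H t)) as [l Hl]; simpl.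
destruct (geometric_cauchy_limit (fun n => P n t) B) as (l' & Hl' & Hb).
{ intros k m Hkm; apply HBb; assumption. }
replace l with l'; [apply Hb|].
apply (filterlim_locally_unique (F := eventually) (fun n => P n t));
  [exact Hl' | apply Hl, Ht].
Qed.

(** Continuity of [f] is asked along continuous curves, which is all that the integral
    equation uses. *)
Theorem picard_lindelof_global : exists X : R -> V,
  X 0 = x0 /\ (forall t, continuous X t) /\
  forall t, 0 <= t -> is_derive X t (f t (X t)).
Proof.
destruct picard_limit as [X0 HX0].
(* The iterates converge only for [t >= 0]; freezing the limit at its value at [0] for
   negative times makes it continuous on the whole line. *)
pose (Y := fun t => X0 (Rmax t 0)).
assert (HY : forall t, continuous Y t).
{ intros t; apply (proj2 (filterlim_norm_iff (locally t) Y (Y t))); intros eps He.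
  destruct (HX0 (Rmax t 0 + 1)) as (B & HB & HBb); [assert (A := Rmax_r t 0); lra|].
  destruct (half_pow_small B (eps / 3) ltac:(lra)) as [n Hn].
  assert (Hc : continuous (fun s => P n (Rmax s 0)) t).
  { apply (continuous_comp (fun s => Rmax s 0) (P n)); [|apply picard_iterate_continuous].
    apply continuous_Rmax_0. }
  generalize (proj1 (filterlim_norm_iff (locally t) _ _) Hc (eps / 3) ltac:(lra));
    clear Hc; intros Hc.
  assert (Hl : locally t (fun s => s < t + 1)) by (apply (open_lt (t + 1) t); lra).
  generalize (filter_and _ _ Hc Hl); apply filter_imp; intros s [Hs Hst]; unfold Y.
  assert (A1 := HBb n (Rmax s 0)); assert (A2 := HBb n (Rmax t 0)).
  assert (0 <= Rmax s 0 <= Rmax t 0 + 1)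
    by (unfold Rmax; destruct (Rle_dec s 0), (Rle_dec t 0); lra).
  assert (0 <= Rmax t 0 <= Rmax t 0 + 1) by (assert (C := Rmax_r t 0); lra).
  specialize (A1 ltac:(assumption)); specialize (A2 ltac:(assumption)).
  apply Rle_lt_trans with (1 := norm_minus_trans_le _ _ _ _ _ A1
    (norm_minus_trans_le _ _ _ _ _ (Rlt_le _ _ Hs) (norm_minus_sym_le _ _ _ A2))).
  lra. }
assert (HYX : forall t, 0 <= t -> Y t = X0 t).
{ intros t Ht; unfold Y; rewrite Rmax_left by lra; reflexivity. }
(* Unlike [Y], the integral [X] is differentiable on both sides of [0]. *)
pose (X := fun t => plus x0 (RInt (fun s => f s (Y s)) 0 t)).
assert (HX : forall t, 0 <= t -> X t = Y t).
{ intros t Ht.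
  destruct (HX0 t Ht) as (B & HB & HBb); destruct (Hlip t) as (K & HK & HL).
  apply (eq_of_norm_minus_small (V := CompleteNormedModule.NormedModule _ V) _ _
    (B * (1 + K * t))).
  intros n.
  assert (A := HBb (S n) t ltac:(lra)); simpl pow in A.
  assert (Hp : 0 <= (1 / 2) ^ n) by (apply pow_le; lra).
  assert (D : norm (minus (X t) (P (S n) t)) <= t * (K * (B * (1 / 2) ^ n))).
  { unfold X, P; simpl picard_iterate; rewrite picard_minus;
      [|exact HY | apply picard_iterate_continuous].
    apply (norm_RInt_le_bound _ (fun _ => K * (B * (1 / 2) ^ n))).
    - exact Ht.
    - intros s; apply (continuous_minus (fun s => f s (Y s)) (fun s => f s (P n s)));
        apply Hcont; [exact HY | apply picard_iterate_continuous].
    - intros s; apply continuous_const.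
    - intros s Hs; apply Rle_trans with (1 := HL s _ _ ltac:(lra)).
      apply Rmult_le_compat_l; [lra|].
      rewrite HYX by lra; apply HBb; lra.
    - rewrite RInt_const; change (scal (t - 0) ?x) with ((t - 0) * x).
      apply Req_le; simpl; ring. }
  assert (0 <= B * (1 / 2) ^ n) by (apply Rmult_le_pos; assumption).
  rewrite HYX by exact Ht.
  apply Rle_trans with (1 := norm_minus_trans_le _ _ _ _ _ D (norm_minus_sym_le _ _ _ A)).
  lra. }
exists X; split; [|split].
- unfold X; transitivity (plus x0 zero).
  + f_equal; apply RInt_point.
  + apply plus_zero_r.
- intros t; apply (continuous_plus (fun _ => x0)); [apply continuous_const|].
  apply ex_derive_continuous; eexists.
  apply (is_derive_RInt_continuity (fun s => f s (Y s)) 0 t).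
  intros s; apply Hcont, HY.
- intros t Ht; rewrite HX by exact Ht; unfold X; evar_last.
  + apply (is_derive_plus (fun _ => x0) (fun t => RInt (fun s => f s (Y s)) 0 t));
      [apply (is_derive_const x0)|].
    apply (is_derive_RInt_continuity (fun s => f s (Y s)) 0 t).
    intros s; apply Hcont, HY.
  + apply plus_zero_l.
Qed.
End Picard.

(** * Completeness of the space of closed curves *)

Definition coord (b : bool) (p : plane) : R := if b then fst p else snd p.

Lemma coord_le_enorm (b : bool) (p : plane) : Rabs (coord b p) <= enorm p.
Proof.
destruct p as [x y].
change (enorm (x, y)) with (sqrt (Rabs x ^ 2 + Rabs y ^ 2)).
rewrite <- (sqrt_pow2 (Rabs (coord b (x, y)))) by apply Rabs_pos.
apply sqrt_le_1_alt.
assert (A := pow2_ge_0 (Rabs x)); assert (B := pow2_ge_0 (Rabs y)).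
destruct b; simpl coord; lra.
Qed.

(** The factor [2] replaces the sharp [sqrt 2]; it lets every estimate be made one
    coordinate at a time. *)
Lemma enorm_le_coord (p : plane) (M : R) :
  (forall b, Rabs (coord b p) <= M) -> enorm p <= 2 * M.
Proof.
intros H; destruct p as [x y].
assert (Hx := H true); assert (Hy := H false); simpl in Hx, Hy.
change (enorm (x, y)) with (sqrt (Rabs x ^ 2 + Rabs y ^ 2)).
assert (A := Rabs_pos x); assert (B := Rabs_pos y).
rewrite <- (sqrt_pow2 (2 * M)) by lra.
apply sqrt_le_1_alt; nra.
Qed.

Lemma coord_vDerive (b : bool) (f : R -> plane) (u : R) :
  coord b (vDerive f u) = Derive (fun x => coord b (f x)) u.
Proof. destruct b; reflexivity. Qed.

Lemma ex_derive_coord (b : bool) (f : R -> plane) (u : R) :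
  C1_periodic f -> ex_derive (fun x => coord b (f x)) u.
Proof. intros (_ & H & _); destruct (H u), b; assumption. Qed.

Lemma continuous_coord (b : bool) (f : R -> plane) (u : R) :
  continuous f u -> continuous (fun x => coord b (f x)) u.
Proof. intros H; apply continuous_pair_iff in H; destruct b; apply H. Qed.

Lemma periodic_Z {T : Type} (f : R -> T) :
  (forall u, f (u + 1) = f u) -> forall (z : Z) (u : R), f (u + IZR z) = f u.
Proof.
intros H.
assert (Hn : forall n x, f (x + INR n) = f x).
{ induction n as [|n IH]; intros x.
  - simpl; rewrite Rplus_0_r; reflexivity.
  - rewrite S_INR, <- Rplus_assoc, H; apply IH. }
intros z u; destruct (Z_le_dec 0 z) as [Hz|Hz].
- rewrite <- (Z2Nat.id z), <- INR_IZR_INZ by assumption; apply Hn.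
- rewrite <- (Hn (Z.to_nat (- z)) (u + IZR z)), INR_IZR_INZ, Z2Nat.id by lia.
  rewrite opp_IZR; f_equal; lra.
Qed.

Lemma periodic_reduce_01 {T : Type} (f : R -> T) (u : R) :
  (forall u, f (u + 1) = f u) -> exists v, 0 <= v <= 1 /\ f u = f v.
Proof.
intros H; exists (frac_part u); split.
- destruct (base_fp u); lra.
- rewrite <- (periodic_Z f H (Int_part u) (frac_part u)); f_equal; unfold frac_part; lra.
Qed.

Lemma Derive_periodic (g : R -> R) (u : R) :
  (forall u, g (u + 1) = g u) -> Derive g (u + 1) = Derive g u.
Proof.
intros H; unfold Derive; f_equal; apply Lim_ext; intros h.
rewrite <- (H u), <- (H (u + h)).
replace (u + 1 + h) with (u + h + 1) by ring; reflexivity.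
Qed.

Lemma vDerive_periodic (f : R -> plane) (u : R) :
  C1_periodic f -> vDerive f (u + 1) = vDerive f u.
Proof.
intros (H & _); unfold vDerive; f_equal; apply Derive_periodic; intros x; rewrite H; reflexivity.
Qed.

Lemma enorm_curve_le_C1_norm (f : C1S) (u : R) : enorm (f u) <= C1_norm f.
Proof.
destruct (periodic_reduce_01 f u (proj1 (curve_C1 f))) as (v & Hv & ->).
assert (A := proj1 (sup_norm_lub _ (curve_continuous f)) v Hv).
assert (C := sup_norm_nonneg _ (vDerive_continuous f)).
unfold C1_norm; lra.
Qed.

Lemma enorm_vDerive_le_sup_norm (f : C1S) (u : R) :
  enorm (vDerive f u) <= sup_norm (vDerive f).
Proof.
destruct (periodic_reduce_01 (vDerive f) u) as (v & Hv & ->).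
{ intros x; apply vDerive_periodic, curve_C1. }
exact (proj1 (sup_norm_lub _ (vDerive_continuous f)) v Hv).
Qed.

Lemma sup_norm_vDerive_le_C1_norm (f : C1S) : sup_norm (vDerive f) <= C1_norm f.
Proof.
assert (C := sup_norm_nonneg _ (curve_continuous f)); unfold C1_norm; lra.
Qed.

Lemma C1_norm_le_coord (f : C1S) (A B : R) :
  (forall b u, Rabs (coord b (f u)) <= A) ->
  (forall b u, Rabs (coord b (vDerive f u)) <= B) ->
  C1_norm f <= 2 * A + 2 * B.
Proof.
intros HA HB; apply Rplus_le_compat.
- apply (sup_norm_lub _ (curve_continuous f)); intros u _; apply enorm_le_coord; auto.
- apply (sup_norm_lub _ (vDerive_continuous f)); intros u _; apply enorm_le_coord; auto.
Qed.

Lemma coord_minus (b : bool) (f g : C1S) (u : R) :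
  coord b ((minus f g : C1S) u) = coord b (f u) - coord b (g u).
Proof. destruct b; reflexivity. Qed.

Lemma coord_vDerive_minus (b : bool) (f g : C1S) (u : R) :
  coord b (vDerive (minus f g : C1S) u)
  = coord b (vDerive f u) - coord b (vDerive g u).
Proof.
rewrite !coord_vDerive.
rewrite <- (Derive_minus (fun x => coord b (f x)) (fun x => coord b (g x)))
  by (apply ex_derive_coord, curve_C1).
apply Derive_ext; intros x; apply coord_minus.
Qed.

Lemma half_pow_le_1 (n : nat) : (1 / 2) ^ n <= 1.
Proof. induction n as [|n IH]; simpl; [apply Rle_refl | lra]. Qed.

(** Uniform convergence of the derivatives makes the limit of the functions
    differentiable. The rates are kept so that they pass to the norm of [C1S]. *)
Lemma C1_uniform_limit (a : nat -> R -> R) (B : R) :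
  (forall n x, ex_derive (a n) x) -> (forall n x, continuous (Derive (a n)) x) ->
  (forall n m x, (n <= m)%nat -> Rabs (a m x - a n x) <= B * (1 / 2) ^ n) ->
  (forall n m x, (n <= m)%nat ->
     Rabs (Derive (a m) x - Derive (a n) x) <= B * (1 / 2) ^ n) ->
  exists l : R -> R,
    (forall x, ex_derive l x) /\ (forall x, continuous (Derive l) x) /\
    (forall n x, Rabs (l x - a n x) <= B * (1 / 2) ^ n) /\
    (forall n x, Rabs (Derive l x - Derive (a n) x) <= B * (1 / 2) ^ n).
Proof.
intros Hd Hc Ha Ha'.
assert (L : forall v : nat -> R -> R,
  (forall n m x, (n <= m)%nat -> Rabs (v m x - v n x) <= B * (1 / 2) ^ n) ->
  exists l : R -> R, forall n x, Rabs (l x - v n x) <= B * (1 / 2) ^ n).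
{ intros v Hv.
  assert (H : forall x, exists l, forall n, Rabs (l - v n x) <= B * (1 / 2) ^ n).
  { intros x.
    destruct (geometric_cauchy_limit (V := R_CompleteNormedModule) (fun n => v n x) B)
      as (l & _ & Hl); [|exists l; exact Hl].
    intros n m Hnm; apply (Hv n m x Hnm). }
  exists (fun x => proj1_sig (constructive_indefinite_description _ (H x))).
  intros n x; destruct (constructive_indefinite_description _ (H x)); simpl; auto. }
destruct (L a Ha) as [l Hl]; destruct (L (fun n => Derive (a n)) Ha') as [l' Hl'].
assert (U : forall (v : nat -> R -> R) (w : R -> R),
  (forall n x, Rabs (w x - v n x) <= B * (1 / 2) ^ n) ->
  forall x (r : posreal), CVU v w x r).
{ intros v w Hv x r eps He.
  destruct (half_pow_small B eps He) as [N HN].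
  exists N; intros n y Hn _; apply Rle_lt_trans with (1 := Hv n y).
  apply Rle_lt_trans with (2 := HN).
  assert (HB : 0 <= B) by (assert (Q := Hv O y); rewrite pow_O, Rmult_1_r in Q;
    apply Rle_trans with (2 := Q), Rabs_pos).
  apply Rmult_le_compat_l; [exact HB|].
  replace n with (N + (n - N))%nat by lia; rewrite pow_add.
  assert (P1 : 0 < (1 / 2) ^ N) by (apply pow_lt; lra).
  assert (P2 := half_pow_le_1 (n - N)).
  nra. }
assert (C' : forall x, continuity_pt l' x).
{ intros x; apply (CVU_continuity (fun n => Derive (a n)) l' x (mkposreal 1 Rlt_0_1)).
  - apply U, Hl'.
  - intros n y _; apply continuity_pt_filterlim, Hc.
  - unfold Boule; rewrite Rminus_diag, Rabs_R0; apply Rlt_0_1. }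
assert (D : forall x, is_derive l x (l' x)).
{ intros x; apply is_derive_Reals.
  apply (CVU_derivable a (fun n => Derive (a n)) l l' x (mkposreal 1 Rlt_0_1)).
  - apply U, Hl'.
  - intros y Hy; apply (CVU_cv a l y (mkposreal 1 Rlt_0_1)); [apply U, Hl|].
    unfold Boule; rewrite Rminus_diag, Rabs_R0; apply Rlt_0_1.
  - intros n y _; apply is_derive_Reals, Derive_correct, Hd.
  - unfold Boule; rewrite Rminus_diag, Rabs_R0; apply Rlt_0_1. }
exists l; split; [|split; [|split]].
- intros x; exists (l' x); apply D.
- intros x; apply (continuous_ext l').
  + intros y; symmetry; apply is_derive_unique, D.
  + apply continuity_pt_filterlim, C'.
- exact Hl.
- intros n x; rewrite (is_derive_unique _ _ _ (D x)); apply Hl'.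
Qed.

Lemma C1S_geometric_limit (g : nat -> C1S) (B : R) :
  (forall n m, (n <= m)%nat -> C1_norm (minus (g m) (g n)) <= B * (1 / 2) ^ n) ->
  exists f : C1S, forall n, C1_norm (minus f (g n)) <= 4 * B * (1 / 2) ^ n.
Proof.
intros Hg.
assert (HL : forall b, exists l : R -> R,
    (forall x, ex_derive l x) /\ (forall x, continuous (Derive l) x) /\
    (forall n x, Rabs (l x - coord b (g n x)) <= B * (1 / 2) ^ n) /\
    (forall n x, Rabs (Derive l x - coord b (vDerive (g n) x)) <= B * (1 / 2) ^ n)).
{ intros b.
  destruct (C1_uniform_limit (fun n x => coord b (g n x)) B) as (l & D & C & L & L').
  - intros n x; apply ex_derive_coord, curve_C1.
  - intros n x; apply (continuous_ext (fun x => coord b (vDerive (g n) x))).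
    + intros y; apply coord_vDerive.
    + apply continuous_coord, vDerive_continuous.
  - intros n m x Hnm; apply Rle_trans with (2 := Hg n m Hnm).
    rewrite <- coord_minus.
    apply Rle_trans with (1 := coord_le_enorm _ _), enorm_curve_le_C1_norm.
  - intros n m x Hnm; apply Rle_trans with (2 := Hg n m Hnm).
    rewrite <- !coord_vDerive, <- coord_vDerive_minus.
    apply Rle_trans with (1 := coord_le_enorm _ _).
    apply Rle_trans with (1 := enorm_vDerive_le_sup_norm _ _), sup_norm_vDerive_le_C1_norm.
  - exists l; repeat split; try assumption.
    intros n x; rewrite coord_vDerive; apply L'. }
destruct (HL true) as (l1 & D1 & C1 & L1 & L1').
destruct (HL false) as (l2 & D2 & C2 & L2 & L2').
assert (Hper : forall b l, (forall n x, Rabs (l x - coord b (g n x)) <= B * (1 / 2) ^ n) ->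
  forall x, l (x + 1) = l x).
{ intros b l Hl x.
  apply (eq_of_norm_minus_small (V := R_NormedModule) (l (x + 1)) (l x) (2 * B)).
  intros n; change (Rabs (l (x + 1) - l x) <= 2 * B * (1 / 2) ^ n).
  assert (A1 := Hl n x); assert (A2 := Hl n (x + 1)).
  rewrite (proj1 (curve_C1 (g n))) in A2.
  revert A1 A2; unfold Rabs; repeat destruct Rcase_abs; lra. }
assert (Hf : C1_periodic (fun x => (l1 x, l2 x))).
{ split; [|split].
  - intros u; rewrite (Hper true l1 L1), (Hper false l2 L2); reflexivity.
  - intros u; simpl; split; [apply D1 | apply D2].
  - intros u; apply continuous_pair_iff; simpl; split; [apply C1 | apply C2]. }
exists (mkC1S _ Hf); intros n.
replace (4 * B * (1 / 2) ^ n) with (2 * (B * (1 / 2) ^ n) + 2 * (B * (1 / 2) ^ n)) by ring.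
apply C1_norm_le_coord; intros b u.
- rewrite coord_minus; destruct b; [apply L1 | apply L2].
- rewrite coord_vDerive_minus, (coord_vDerive b (mkC1S _ Hf)).
  destruct b; [apply L1' | apply L2'].
Qed.

(** The choice depends only on the predicate, so equivalent filters, being equal as
    predicates, have the same limit. *)
Definition C1S_lim (F : (C1S -> Prop) -> Prop) : C1S :=
  epsilon (inhabits (zero : C1S)) (fun f => forall eps : posreal, F (ball f eps)).

(** A Cauchy filter contains a ball of radius [(1/2)^n] for each [n]; the centres form a
    geometric Cauchy sequence because any two such balls meet. *)
Lemma C1S_complete (F : (C1S -> Prop) -> Prop) : ProperFilter F -> cauchy F ->
  forall eps : posreal, F (ball (C1S_lim F) eps).
Proof.
intros FF HF.
assert (Hp : forall n, 0 < (1 / 2) ^ n) by (intros n; apply pow_lt; lra).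
assert (Hg : forall n, exists f : C1S, F (ball f ((1 / 2) ^ n)))
  by (intros n; apply (HF (mkposreal _ (Hp n)))).
pose (g := fun n => proj1_sig (constructive_indefinite_description _ (Hg n))).
assert (HgF : forall n, F (ball (g n) ((1 / 2) ^ n))).
{ intros n; unfold g; destruct (constructive_indefinite_description _ (Hg n)); assumption. }
apply (epsilon_spec (inhabits (zero : C1S)) (fun f => forall eps : posreal, F (ball f eps))).
destruct (C1S_geometric_limit g 2) as [f Hf].
- intros n m Hnm.
  destruct (filter_ex _ (filter_and _ _ (HgF n) (HgF m))) as [h [Hn Hm]].
  assert (A := norm_minus_trans_le (V := C1S_NormedModule) _ _ _ _ _
    (norm_minus_sym_le (V := C1S_NormedModule) _ _ _ (Rlt_le _ _ Hm)) (Rlt_le _ _ Hn)).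
  apply Rle_trans with (1 := A).
  replace m with (n + (m - n))%nat by lia; rewrite pow_add.
  assert (P := half_pow_le_1 (m - n)).
  assert (Q := Hp n); nra.
- exists f; intros eps.
  destruct (half_pow_small 9 eps (cond_pos eps)) as [n Hn].
  generalize (HgF n); apply filter_imp; intros h Hh.
  assert (A := norm_minus_trans_le (V := C1S_NormedModule) _ _ _ _ _
    (Rlt_le _ _ Hh) (norm_minus_sym_le (V := C1S_NormedModule) _ _ _ (Hf n))).
  apply Rle_lt_trans with (1 := A); lra.
Qed.

Definition C1S_CompleteSpace_mixin : CompleteSpace.mixin_of C1S_UniformSpace.
Proof.
refine (CompleteSpace.Mixin C1S_UniformSpace C1S_lim C1S_complete _).
intros F1 F2 H12 H21.
replace F2 with F1; [intros eps; apply ball_center|].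
apply functional_extensionality; intros P; apply propositional_extensionality; split; auto.
Defined.

Canonical C1S_CompleteNormedModule : CompleteNormedModule R_AbsRing :=
  CompleteNormedModule.Pack R_AbsRing C1S
    (CompleteNormedModule.Class R_AbsRing C1S
      (NormedModule.class R_AbsRing C1S_NormedModule) C1S_CompleteSpace_mixin) C1S.

(** * Exponential integrals along a closed curve *)

Lemma RInt_periodic (f : R -> R) (u : R) :
  (forall x, f (x + 1) = f x) -> ex_RInt f u (u + 1) ->
  RInt f 0 1 = RInt f u (u + 1).
Proof.
intros Hf Hex.
assert (HZ := periodic_Z f Hf).
(* Cut the period at the integer [n] in [u, u + 1] and move both pieces into [0, 1]. *)
destruct (archimed u) as [Hn1 Hn2]; set (n := up u) in *.
assert (H1 : ex_RInt f u (IZR n))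
  by (apply (ex_RInt_Chasles_1 (V := R_CompleteNormedModule) f u (IZR n) (u + 1)); [lra | exact Hex]).
assert (H2 : ex_RInt f (IZR n) (u + 1))
  by (apply (ex_RInt_Chasles_2 (V := R_CompleteNormedModule) f u (IZR n) (u + 1)); [lra | exact Hex]).
assert (T : forall (z : Z) a b, ex_RInt f (a + IZR z) (b + IZR z) ->
  is_RInt f a b (RInt f (a + IZR z) (b + IZR z))).
{ intros z a b Hab.
  apply (is_RInt_ext (fun y => scal 1 (f (1 * y + IZR z)))).
  - intros y _; change (1 * f (1 * y + IZR z) = f y); rewrite !Rmult_1_l; apply HZ.
  - apply (is_RInt_comp_lin (V := R_NormedModule) f 1 (IZR z) a b); rewrite !Rmult_1_l.
    apply (RInt_correct (V := R_CompleteNormedModule)), Hab. }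
assert (A := T n 0 (u + 1 - IZR n)).
assert (B := T (n - 1)%Z (u + 1 - IZR n) 1).
rewrite minus_IZR in B.
replace (0 + IZR n) with (IZR n) in A by ring.
replace (u + 1 - IZR n + IZR n) with (u + 1) in A by ring.
replace (u + 1 - IZR n + (IZR n - 1)) with u in B by ring.
replace (1 + (IZR n - 1)) with (IZR n) in B by ring.
assert (C := is_RInt_Chasles _ _ _ _ _ _ (A H2) (B H1)).
rewrite (is_RInt_unique (V := R_CompleteNormedModule) _ _ _ _ C).
rewrite <- (RInt_Chasles (V := R_CompleteNormedModule) f u (IZR n) (u + 1) H1 H2).
apply plus_comm.
Qed.

Lemma ex_RInt_R (f : R -> R) (a b : R) : (forall t, continuous f t) -> ex_RInt f a b.
Proof. apply (ex_RInt_continuity (V := R_CompleteNormedModule)). Qed.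

Lemma is_derive_RInt_R (f : R -> R) (a t : R) :
  (forall t, continuous f t) -> is_derive (fun t => RInt f a t) t (f t).
Proof. apply (is_derive_RInt_continuity (V := R_CompleteNormedModule)). Qed.

Lemma RInt_Chasles_minus (f : R -> R) (a b : R) : (forall t, continuous f t) ->
  RInt f 0 b - RInt f 0 a = RInt f a b.
Proof.
intros Hf.
rewrite <- (RInt_Chasles (V := R_CompleteNormedModule) f 0 a b) by (apply ex_RInt_R, Hf).
change (RInt f 0 a + RInt f a b - RInt f 0 a = RInt f a b); ring.
Qed.

Lemma Rabs_RInt_le (f g : R -> R) (a b : R) : a <= b ->
  (forall t, continuous f t) -> (forall t, continuous g t) ->
  (forall t, a <= t <= b -> Rabs (f t) <= g t) ->
  Rabs (RInt f a b) <= RInt g a b.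
Proof.
intros Hab Hf Hg Hle.
apply (norm_RInt_le (V := R_NormedModule) f g a b); [exact Hab | exact Hle | |];
  apply (RInt_correct (V := R_CompleteNormedModule)), ex_RInt_R; assumption.
Qed.

Lemma continuous_Rmult (f g : R -> R) (t : R) :
  continuous f t -> continuous g t -> continuous (fun x => f x * g x) t.
Proof. apply (continuous_mult (K := R_AbsRing) f g). Qed.

Definition arc (s : R -> R) (u : R) : R := RInt s 0 u.

(** The kernel and its primitive are combinations of [exp (x / lambda)] and
    [exp (- x / lambda)]; this is the convolution of [w] with one such exponential in
    the arc-length ratio [x]. *)
Definition expint (th : R) (s w : R -> R) (u : R) : R :=
  RInt (fun v => w v * exp (th * ((arc s v - arc s u) / arc s 1))) u (u + 1).

(** [s] is the speed of a closed curve and [w] one coordinate of its velocity. *)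
Definition speed_data (s w : R -> R) : Prop :=
  (forall u, continuous s u) /\ (forall u, continuous w u) /\
  (forall u, s (u + 1) = s u) /\ (forall u, w (u + 1) = w u) /\
  (forall u, Rabs (w u) <= s u).

(** One constant large enough for all the estimates on [expint] and its derivative. *)
Definition Cexp (th : R) : R := exp (Rabs th) * (2 + 2 * Rabs th) * (1 + Rabs th).

Section OneCurve.
Context (s w : R -> R) (Hsw : speed_data s w).

Lemma speed_continuous (u : R) : continuous s u.
Proof. apply Hsw. Qed.

Lemma velocity_continuous (u : R) : continuous w u.
Proof. apply Hsw. Qed.

Lemma speed_nonneg (u : R) : 0 <= s u.
Proof. apply Rle_trans with (Rabs (w u)); [apply Rabs_pos | apply Hsw]. Qed.

Lemma is_derive_arc (u : R) : is_derive (arc s) u (s u).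
Proof. apply is_derive_RInt_R, speed_continuous. Qed.

Lemma arc_minus (a b : R) : arc s b - arc s a = RInt s a b.
Proof. apply RInt_Chasles_minus, speed_continuous. Qed.

Lemma arc_shift (u : R) : arc s (u + 1) = arc s u + arc s 1.
Proof.
assert (A := arc_minus u (u + 1)).
rewrite <- (RInt_periodic s u) in A.
- unfold arc in *; lra.
- apply Hsw.
- apply ex_RInt_R, speed_continuous.
Qed.

Lemma arc_increasing (a b : R) : a <= b -> arc s a <= arc s b.
Proof.
intros Hab; assert (A := arc_minus a b).
assert (0 <= RInt s a b); [|lra].
apply RInt_ge_0; [exact Hab | apply ex_RInt_R, speed_continuous|].
intros; apply speed_nonneg.
Qed.

Lemma arc_ratio (u v : R) : 0 < arc s 1 -> u <= v <= u + 1 ->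
  0 <= (arc s v - arc s u) / arc s 1 <= 1.
Proof.
intros HL Hv.
assert (A := arc_increasing u v ltac:(lra)).
assert (B := arc_increasing v (u + 1) ltac:(lra)); rewrite arc_shift in B.
split.
- apply Rle_mult_inv_pos; lra.
- apply Rmult_le_reg_r with (arc s 1); [exact HL|]; field_simplify; lra.
Qed.

Lemma arc_pos_of_neq_0 : arc s 1 <> 0 -> 0 < arc s 1.
Proof.
intros H; assert (A := arc_increasing 0 1 ltac:(lra)).
unfold arc in *; rewrite (RInt_point (V := R_CompleteNormedModule)) in A.
change (0 <= RInt s 0 1) in A; lra.
Qed.

Lemma exp_arc_continuous (k c u : R) : continuous (fun v => exp (k * ((arc s v - c) / arc s 1))) u.
Proof.
apply (ex_derive_continuous (fun v => exp (k * ((arc s v - c) / arc s 1)))).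
auto_derive; eexists; apply is_derive_arc.
Qed.

Lemma expint_integrand_continuous (th u v : R) :
  continuous (fun v => w v * exp (th * ((arc s v - arc s u) / arc s 1))) v.
Proof. apply continuous_Rmult; [apply velocity_continuous | apply exp_arc_continuous]. Qed.

Lemma expint_factor (th u : R) :
  expint th s w u = exp (- (th * (arc s u / arc s 1))) *
    (RInt (fun v => w v * exp (th * ((arc s v - 0) / arc s 1))) 0 (u + 1)
     - RInt (fun v => w v * exp (th * ((arc s v - 0) / arc s 1))) 0 u).
Proof.
assert (C : forall t, continuous (fun v => w v * exp (th * ((arc s v - 0) / arc s 1))) t).
{ intros t; apply continuous_Rmult; [apply velocity_continuous | apply exp_arc_continuous]. }
rewrite RInt_Chasles_minus by exact C.
change (?a * RInt ?f u (u + 1)) with (scal a (RInt f u (u + 1))).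
rewrite <- (RInt_scal (V := R_CompleteNormedModule)) by (apply ex_RInt_R, C).
apply RInt_ext; intros v _.
change (scal ?a (w v * ?b)) with (a * (w v * b)).
rewrite <- Rmult_assoc, (Rmult_comm _ (w v)), Rmult_assoc, <- exp_plus.
f_equal; f_equal; unfold Rdiv; ring.
Qed.

(** The exponential splits as [exp (a * arc s v) * exp (- a * arc s u)], so no
    derivative is taken under the integral: the endpoints [u + 1] and [u] give
    [w u * (exp th - 1)], the outer factor gives the other term. *)
Lemma is_derive_expint (th u : R) : 0 < arc s 1 ->
  is_derive (expint th s w) u
    (w u * (exp th - 1) - th * (s u / arc s 1) * expint th s w u).
Proof.
intros HL.
pose (m := fun v => w v * exp (th * ((arc s v - 0) / arc s 1))).
assert (C : forall t, continuous m t).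
{ intros t; apply continuous_Rmult; [apply velocity_continuous | apply exp_arc_continuous]. }
pose (M := fun x => RInt m 0 x).
apply (is_derive_ext (fun x => exp (- (th * (arc s x / arc s 1))) * (M (x + 1) - M x))).
{ intros x; symmetry; apply expint_factor. }
assert (DM : forall x, is_derive M x (m x)) by (intros x; apply is_derive_RInt_R, C).
assert (DM1 : is_derive (fun x => M (x + 1)) u (m (u + 1))).
{ evar_last.
  - apply (is_derive_comp M (fun x => x + 1) u); [apply DM|].
    auto_derive; [trivial | reflexivity].
  - apply Rmult_1_l. }
assert (DE : is_derive (fun x => exp (- (th * (arc s x / arc s 1)))) u
  (- (th * (s u / arc s 1)) * exp (- (th * (arc s u / arc s 1))))).
{ auto_derive; [eexists; apply is_derive_arc|].
  replace (Derive (fun x : R => arc s x) u) with (s u)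
    by (symmetry; apply is_derive_unique, is_derive_arc).
  unfold Rdiv; ring. }
evar_last.
- apply (is_derive_mult (fun x => exp (- (th * (arc s x / arc s 1))))
    (fun x => M (x + 1) - M x) u); [exact DE | | exact Rmult_comm].
  apply (is_derive_minus (fun x => M (x + 1)) M); [exact DM1 | apply DM].
- rewrite expint_factor.
  fold m; fold (M (u + 1)); fold (M u).
  change (- (th * (s u / arc s 1)) * exp (- (th * (arc s u / arc s 1))) * (M (u + 1) - M u)
    + exp (- (th * (arc s u / arc s 1))) * (m (u + 1) - m u)
    = w u * (exp th - 1) - th * (s u / arc s 1) *
      (exp (- (th * (arc s u / arc s 1))) * (M (u + 1) - M u))).
  assert (E : exp (- (th * (arc s u / arc s 1))) * (m (u + 1) - m u) = w u * (exp th - 1)).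
  { unfold m; rewrite (proj1 (proj2 (proj2 (proj2 Hsw)))), arc_shift.
    rewrite Rmult_minus_distr_l, (Rmult_comm (w u)), (Rmult_comm (w u)), <- !Rmult_assoc, <- !exp_plus.
    replace (- (th * (arc s u / arc s 1)) + th * ((arc s u + arc s 1 - 0) / arc s 1)) with th
      by (field; lra).
    replace (- (th * (arc s u / arc s 1)) + th * ((arc s u - 0) / arc s 1)) with 0
      by (field; lra).
    rewrite exp_0; ring. }
  rewrite E; ring.
Qed.

Lemma exp_mult_le (th x : R) : 0 <= x <= 1 -> exp (th * x) <= exp (Rabs th).
Proof.
intros Hx; apply exp_le_exp.
assert (A := Rle_abs th); assert (B := Rabs_pos th); nra.
Qed.

Lemma Cexp_bounds (th : R) :
  exp (Rabs th) <= Cexp th /\ exp (Rabs th) * (1 + 2 * Rabs th) <= Cexp th /\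
  exp (Rabs th) * (2 + Rabs th) <= Cexp th /\
  exp (Rabs th) * (Rabs th * (2 + 2 * Rabs th)) <= Cexp th.
Proof.
assert (A := exp_pos (Rabs th)); assert (B := Rabs_pos th).
assert (0 <= exp (Rabs th) * Rabs th) by nra.
assert (0 <= exp (Rabs th) * Rabs th * Rabs th) by nra.
unfold Cexp; repeat split; nra.
Qed.

(** Since [|w| <= s], the integral is controlled by the length and not only by the
    maximal speed; this compensates each division by [arc s 1]. *)
Lemma Rabs_expint_le (th u : R) : 0 < arc s 1 ->
  Rabs (expint th s w u) <= exp (Rabs th) * arc s 1.
Proof.
intros HL.
apply Rle_trans with (RInt (fun v => exp (Rabs th) * s v) u (u + 1)).
- apply Rabs_RInt_le; [lra | apply expint_integrand_continuous | |].
  + intros t; apply (continuous_scal_r (exp (Rabs th)) s), speed_continuous.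
  + intros v Hv.
    rewrite Rabs_mult, (Rabs_pos_eq (exp _)) by apply Rlt_le, exp_pos.
    rewrite Rmult_comm; apply Rmult_le_compat.
    * apply Rlt_le, exp_pos.
    * apply Rabs_pos.
    * apply exp_mult_le, arc_ratio; assumption.
    * apply Hsw.
- apply Req_le.
  rewrite (RInt_scal (V := R_CompleteNormedModule) s) by (apply ex_RInt_R, speed_continuous).
  rewrite <- (RInt_periodic s u); [reflexivity | apply Hsw | apply ex_RInt_R, speed_continuous].
Qed.

Lemma Rabs_exp_minus_1_le (th : R) : Rabs (exp th - 1) <= 2 * exp (Rabs th).
Proof.
assert (A := exp_pos th); assert (B : exp th <= exp (Rabs th)) by apply exp_le_exp, Rle_abs.
assert (C : exp 0 <= exp (Rabs th)) by apply exp_le_exp, Rabs_pos.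
rewrite exp_0 in C; apply Rabs_le; lra.
Qed.

Lemma Rabs_derive_expint_le (th u : R) : 0 < arc s 1 ->
  Rabs (w u * (exp th - 1) - th * (s u / arc s 1) * expint th s w u) <= Cexp th * s u.
Proof.
intros HL.
assert (A := Rabs_expint_le th u HL).
assert (B := Rabs_exp_minus_1_le th).
assert (Hw : Rabs (w u) <= s u) by apply Hsw.
assert (Hs := speed_nonneg u).
apply Rle_trans with (exp (Rabs th) * (2 + Rabs th) * s u).
2: { apply Rmult_le_compat_r; [exact Hs | apply Cexp_bounds]. }
apply Rle_trans with (1 := Rabs_triang _ _); rewrite Rabs_Ropp, !Rabs_mult.
rewrite (Rabs_pos_eq (s u / arc s 1)) by (apply Rle_mult_inv_pos; assumption).
assert (C : Rabs (w u) * Rabs (exp th - 1) <= s u * (2 * exp (Rabs th)))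
  by (apply Rmult_le_compat; try apply Rabs_pos; assumption).
assert (D : Rabs th * (s u / arc s 1) * Rabs (expint th s w u)
  <= Rabs th * (s u / arc s 1) * (exp (Rabs th) * arc s 1)).
{ apply Rmult_le_compat_l; [|exact A].
  apply Rmult_le_pos; [apply Rabs_pos | apply Rle_mult_inv_pos; assumption]. }
replace (Rabs th * (s u / arc s 1) * (exp (Rabs th) * arc s 1))
  with (Rabs th * s u * exp (Rabs th)) in D by (field; lra).
lra.
Qed.

End OneCurve.

Lemma exp_lipschitz (th x y : R) : 0 <= x <= 1 -> 0 <= y <= 1 ->
  Rabs (exp (th * x) - exp (th * y)) <= Rabs th * exp (Rabs th) * Rabs (x - y).
Proof.
intros Hx Hy.
destruct (MVT_gen (fun z => exp (th * z)) y x (fun z => th * exp (th * z))) as [c [Hc E]].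
- intros z _; auto_derive; [trivial | ring].
- intros z _; apply continuity_pt_filterlim.
  apply (ex_derive_continuous (fun z => exp (th * z))); auto_derive; trivial.
- assert (Hc1 : 0 <= c <= 1).
  { unfold Rmin, Rmax in Hc; destruct (Rle_dec y x); lra. }
  rewrite E, !Rabs_mult; apply Rmult_le_compat_r; [apply Rabs_pos|].
  apply Rmult_le_compat_l; [apply Rabs_pos|].
  rewrite Rabs_pos_eq by apply Rlt_le, exp_pos; apply exp_mult_le, Hc1.
Qed.

Section TwoCurves.
Context (s1 w1 s2 w2 : R -> R) (D : R).
Context (H1 : speed_data s1 w1) (H2 : speed_data s2 w2).
Context (HDs : forall u, Rabs (s1 u - s2 u) <= D) (HDw : forall u, Rabs (w1 u - w2 u) <= D).

Lemma speed_distance_nonneg : 0 <= D.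
Proof. apply Rle_trans with (2 := HDs 0), Rabs_pos. Qed.

Lemma Rabs_arc_minus_le (u v : R) : u <= v <= u + 1 ->
  Rabs ((arc s1 v - arc s1 u) - (arc s2 v - arc s2 u)) <= D.
Proof.
intros Huv.
rewrite (arc_minus s1 w1 H1), (arc_minus s2 w2 H2).
change (RInt s1 u v - RInt s2 u v) with (minus (RInt s1 u v) (RInt s2 u v)).
rewrite <- (RInt_minus (V := R_CompleteNormedModule) s1 s2)
  by (apply ex_RInt_R; apply H1 || apply H2).
apply Rle_trans with (RInt (fun _ => D) u v).
- apply Rabs_RInt_le; [lra | | intros; apply continuous_const | intros; apply HDs].
  intros t; apply (continuous_minus s1 s2);
    [apply (speed_continuous s1 w1 H1) | apply (speed_continuous s2 w2 H2)].
- rewrite RInt_const; change (scal (v - u) D) with ((v - u) * D).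
  assert (A := speed_distance_nonneg); nra.
Qed.

Lemma Rabs_length_minus_le : Rabs (arc s1 1 - arc s2 1) <= D.
Proof.
assert (A := Rabs_arc_minus_le 0 1 ltac:(lra)).
assert (Z : forall s, arc s 0 = 0).
{ intros s; unfold arc; apply (RInt_point (V := R_CompleteNormedModule)). }
rewrite !Z, !Rminus_0_r in A; exact A.
Qed.

(** Only the first length appears in the denominator: the ratio of the second curve is
    at most [1], so it multiplies the difference of the lengths harmlessly. *)
Lemma arc_ratio_lipschitz (u v : R) : 0 < arc s1 1 -> 0 < arc s2 1 -> u <= v <= u + 1 ->
  Rabs ((arc s1 v - arc s1 u) / arc s1 1 - (arc s2 v - arc s2 u) / arc s2 1)
  <= 2 * D / arc s1 1.
Proof.
intros HL1 HL2 Huv.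
assert (A := Rabs_arc_minus_le u v Huv).
assert (B := Rabs_length_minus_le).
assert (C := arc_ratio s2 w2 H2 u v HL2 Huv).
set (x2 := (arc s2 v - arc s2 u) / arc s2 1) in *.
replace (arc s2 v - arc s2 u) with (x2 * arc s2 1) in A by (unfold x2; field; lra).
apply Rmult_le_reg_r with (arc s1 1); [exact HL1|].
rewrite <- (Rabs_pos_eq (arc s1 1)) at 2 by lra.
rewrite <- Rabs_mult.
replace (2 * D / arc s1 1 * arc s1 1) with (D + D) by (field; lra).
replace (((arc s1 v - arc s1 u) / arc s1 1 - x2) * arc s1 1)
  with (((arc s1 v - arc s1 u) - x2 * arc s2 1) + - (x2 * (arc s1 1 - arc s2 1))) by (field; lra).
apply Rle_trans with (1 := Rabs_triang _ _); apply Rplus_le_compat; [exact A|].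
rewrite Rabs_Ropp, Rabs_mult, (Rabs_pos_eq x2) by lra.
assert (P := Rabs_pos (arc s1 1 - arc s2 1)); nra.
Qed.

(** The factor [1 / arc s1 1] coming from the ratios is integrated against [|w1| <= s1],
    whose integral is [arc s1 1]: the bound does not see the length. *)
Lemma expint_lipschitz (th u : R) : 0 < arc s1 1 -> 0 < arc s2 1 ->
  Rabs (expint th s1 w1 u - expint th s2 w2 u) <= exp (Rabs th) * (1 + 2 * Rabs th) * D.
Proof.
intros HL1 HL2; unfold expint.
set (f1 := fun v => w1 v * exp (th * ((arc s1 v - arc s1 u) / arc s1 1))).
set (f2 := fun v => w2 v * exp (th * ((arc s2 v - arc s2 u) / arc s2 1))).
assert (C1 : forall t, continuous f1 t) by (intros; apply (expint_integrand_continuous s1 w1 H1)).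
assert (C2 : forall t, continuous f2 t) by (intros; apply (expint_integrand_continuous s2 w2 H2)).
change (RInt f1 u (u + 1) - RInt f2 u (u + 1)) with (minus (RInt f1 u (u + 1)) (RInt f2 u (u + 1))).
rewrite <- (RInt_minus (V := R_CompleteNormedModule) f1 f2) by (apply ex_RInt_R; assumption).
set (k := Rabs th * exp (Rabs th) * (2 * D / arc s1 1)).
apply Rle_trans with (RInt (fun v => plus (D * exp (Rabs th)) (scal k (s1 v))) u (u + 1)).
- apply Rabs_RInt_le; [lra | intros t; apply (continuous_minus f1 f2); auto | |].
  + intros t; apply (continuous_plus (fun _ => D * exp (Rabs th)) (fun v => scal k (s1 v)));
      [apply continuous_const|].
    apply (continuous_scal_r k s1), (speed_continuous s1 w1 H1).
  + intros v Hv; unfold f1, f2.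
    assert (R1 := arc_ratio s1 w1 H1 u v HL1 Hv).
    assert (R2 := arc_ratio s2 w2 H2 u v HL2 Hv).
    assert (Q := exp_lipschitz th _ _ R1 R2).
    assert (Q' := arc_ratio_lipschitz u v HL1 HL2 Hv).
    assert (X := exp_mult_le th _ R2).
    set (x1 := (arc s1 v - arc s1 u) / arc s1 1) in *.
    set (x2 := (arc s2 v - arc s2 u) / arc s2 1) in *.
    change (Rabs (w1 v * exp (th * x1) - w2 v * exp (th * x2)) <= D * exp (Rabs th) + k * s1 v).
    replace (w1 v * exp (th * x1) - w2 v * exp (th * x2))
      with ((w1 v - w2 v) * exp (th * x2) + (exp (th * x1) - exp (th * x2)) * w1 v) by ring.
    apply Rle_trans with (1 := Rabs_triang _ _); rewrite !Rabs_mult.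
    apply Rplus_le_compat; apply Rmult_le_compat; try apply Rabs_pos.
    * apply HDw.
    * rewrite Rabs_pos_eq by apply Rlt_le, exp_pos; exact X.
    * apply Rle_trans with (1 := Q); unfold k; apply Rmult_le_compat_l; [|exact Q'].
      apply Rmult_le_pos; [apply Rabs_pos | apply Rlt_le, exp_pos].
    * apply H1.
- apply Req_le.
  rewrite (RInt_plus (V := R_CompleteNormedModule) (fun _ => D * exp (Rabs th)) (fun v => scal k (s1 v))).
  + rewrite RInt_const, (RInt_scal (V := R_CompleteNormedModule) s1)
      by (apply ex_RInt_R, (speed_continuous s1 w1 H1)).
    rewrite <- (RInt_periodic s1 u);
      [| apply H1 | apply ex_RInt_R, (speed_continuous s1 w1 H1)].
    change ((u + 1 - u) * (D * exp (Rabs th)) + k * arc s1 1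
      = exp (Rabs th) * (1 + 2 * Rabs th) * D).
    unfold k; field; lra.
  + apply ex_RInt_R; intros; apply continuous_const.
  + apply ex_RInt_R; intros; apply (continuous_scal_r k s1), (speed_continuous s1 w1 H1).
Qed.

(** The quotient [s1 u / arc s1 1] is no longer integrated and survives in the bound.
    The second quotient is always multiplied by an integral of size [arc s2 1]. *)
Lemma derive_expint_lipschitz (th u : R) : 0 < arc s1 1 -> 0 < arc s2 1 ->
  Rabs ((w1 u * (exp th - 1) - th * (s1 u / arc s1 1) * expint th s1 w1 u)
        - (w2 u * (exp th - 1) - th * (s2 u / arc s2 1) * expint th s2 w2 u))
  <= Cexp th * (1 + s1 u / arc s1 1) * D.
Proof.
intros HL1 HL2.
assert (A := expint_lipschitz th u HL1 HL2).
assert (B := Rabs_expint_le s2 w2 H2 th u HL2).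
assert (X := Rabs_exp_minus_1_le th).
assert (HD := speed_distance_nonneg).
set (e1 := expint th s1 w1 u) in *; set (e2 := expint th s2 w2 u) in *.
set (q := s1 u / arc s1 1).
assert (Hq : 0 <= q) by (apply Rle_mult_inv_pos; [apply (speed_nonneg s1 w1 H1) | exact HL1]).
assert (Y : arc s2 1 * Rabs (q - s2 u / arc s2 1) <= (1 + q) * D).
{ rewrite <- (Rabs_pos_eq (arc s2 1)) at 1 by lra; rewrite <- Rabs_mult.
  replace (arc s2 1 * (q - s2 u / arc s2 1))
    with ((s1 u - s2 u) + - (q * (arc s1 1 - arc s2 1))) by (unfold q; field; lra).
  apply Rle_trans with (1 := Rabs_triang _ _).
  rewrite Rabs_Ropp, Rabs_mult, (Rabs_pos_eq q) by exact Hq.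
  assert (P := HDs u); assert (P' := Rabs_length_minus_le); nra. }
assert (Z : Rabs (q * e1 - s2 u / arc s2 1 * e2)
  <= exp (Rabs th) * (2 + 2 * Rabs th) * (1 + q) * D).
{ replace (q * e1 - s2 u / arc s2 1 * e2)
    with (q * (e1 - e2) + (q - s2 u / arc s2 1) * e2) by ring.
  apply Rle_trans with (1 := Rabs_triang _ _); rewrite !Rabs_mult, (Rabs_pos_eq q) by exact Hq.
  apply Rle_trans with (q * (exp (Rabs th) * (1 + 2 * Rabs th) * D)
    + exp (Rabs th) * ((1 + q) * D)).
  - apply Rplus_le_compat; [apply Rmult_le_compat_l; assumption|].
    apply Rle_trans with (Rabs (q - s2 u / arc s2 1) * (exp (Rabs th) * arc s2 1)).
    + apply Rmult_le_compat_l; [apply Rabs_pos | exact B].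
    + replace (Rabs (q - s2 u / arc s2 1) * (exp (Rabs th) * arc s2 1))
        with (exp (Rabs th) * (arc s2 1 * Rabs (q - s2 u / arc s2 1))) by ring.
      apply Rmult_le_compat_l; [apply Rlt_le, exp_pos | exact Y].
  - assert (P : 0 <= exp (Rabs th) * (1 + 2 * Rabs th) * D).
    { apply Rmult_le_pos; [|exact HD].
      assert (P1 := exp_pos (Rabs th)); assert (P2 := Rabs_pos th); nra. }
    nra. }
replace ((w1 u * (exp th - 1) - th * q * e1) - (w2 u * (exp th - 1) - th * (s2 u / arc s2 1) * e2))
  with ((w1 u - w2 u) * (exp th - 1) + - (th * (q * e1 - s2 u / arc s2 1 * e2))) by ring.
apply Rle_trans with (1 := Rabs_triang _ _); rewrite Rabs_Ropp, !Rabs_mult.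
apply Rle_trans with (D * (2 * exp (Rabs th))
  + Rabs th * (exp (Rabs th) * (2 + 2 * Rabs th) * (1 + q) * D)).
- apply Rplus_le_compat.
  + apply Rmult_le_compat; try apply Rabs_pos; [apply HDw | exact X].
  + apply Rmult_le_compat_l; [apply Rabs_pos | exact Z].
- assert (P1 := exp_pos (Rabs th)); assert (P2 := Rabs_pos th).
  assert (P : 0 <= D * exp (Rabs th)) by nra.
  assert (P3 : 0 <= D * exp (Rabs th) * q) by nra.
  assert (P4 : 0 <= D * exp (Rabs th) * Rabs th) by nra.
  assert (P5 : 0 <= D * exp (Rabs th) * q * Rabs th) by nra.
  unfold Cexp; nra.
Qed.

End TwoCurves.

(** * The kernel and integration by parts *)

Lemma frac_part_id (x : R) : 0 <= x < 1 -> frac_part x = x.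
Proof.
intros Hx; unfold frac_part.
rewrite <- (Int_part_spec x 0) by (simpl; lra); simpl; ring.
Qed.

Lemma frac_part_plus_1 (x : R) : frac_part (x + 1) = frac_part x.
Proof.
unfold frac_part; destruct (base_Int_part x) as [A B].
rewrite <- (Int_part_spec (x + 1) (Int_part x + 1)); rewrite plus_IZR; simpl; lra.
Qed.

Lemma cosh_even (x : R) : cosh (- x) = cosh x.
Proof. unfold cosh; rewrite Ropp_involutive; f_equal; ring. Qed.

(** At [x = 1] the fractional part is [0], where [kernel01] takes the same value by
    symmetry about [1/2]. *)
Lemma Gker_unit_interval (lambda x : R) : 0 <= x <= 1 -> Gker lambda x = kernel01 lambda x.
Proof.
intros Hx; unfold Gker; destruct (Rle_lt_or_eq_dec x 1 (proj2 Hx)) as [H| ->].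
- rewrite frac_part_id by lra; reflexivity.
- replace 1 with (0 + 1) at 1 by ring; rewrite frac_part_plus_1, frac_part_id by lra.
  unfold kernel01; rewrite Rabs_R0, Rabs_R1.
  replace ((0 - 1 / 2) / lambda) with (- ((1 - 1 / 2) / lambda))
    by (replace (0 - 1 / 2) with (- (1 - 1 / 2)) by lra; unfold Rdiv; ring).
  rewrite cosh_even; reflexivity.
Qed.

(** The primitive of the kernel that is odd about the midpoint of [[0, 1]]. The kernel has
    total mass [-1], so its values at [0] and [1] are [1/2] and [- (1/2)]. *)
Definition kernel_prim (lambda x : R) : R :=
  - (sinh ((x - 1 / 2) / lambda) / (2 * sinh (1 / (2 * lambda)))).

Definition kernel_amp_pos (lambda : R) : R :=
  - (exp (- (1 / (2 * lambda))) / (4 * sinh (1 / (2 * lambda)))).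

Definition kernel_amp_neg (lambda : R) : R :=
  exp (1 / (2 * lambda)) / (4 * sinh (1 / (2 * lambda))).

Lemma sinh_half_pos (lambda : R) : 0 < lambda -> 0 < sinh (1 / (2 * lambda)).
Proof.
intros Hl; rewrite <- sinh_0; apply sinh_lt.
apply Rdiv_lt_0_compat; lra.
Qed.

Lemma kernel_prim_exp (lambda x : R) : 0 < lambda ->
  kernel_prim lambda x = kernel_amp_pos lambda * exp (1 / lambda * x)
    + kernel_amp_neg lambda * exp (- (1 / lambda) * x).
Proof.
intros Hl; assert (A := sinh_half_pos lambda Hl).
unfold kernel_prim, kernel_amp_pos, kernel_amp_neg.
set (S := sinh (1 / (2 * lambda))) in *.
unfold sinh.
replace ((x - 1 / 2) / lambda) with (- (1 / (2 * lambda)) + 1 / lambda * x) by (field; lra).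
replace (- (- (1 / (2 * lambda)) + 1 / lambda * x))
  with (1 / (2 * lambda) + - (1 / lambda) * x) by ring.
rewrite !exp_plus; field; lra.
Qed.

Lemma kernel_prim_0 (lambda : R) : 0 < lambda -> kernel_prim lambda 0 = 1 / 2.
Proof.
intros Hl; assert (A := sinh_half_pos lambda Hl); unfold kernel_prim.
replace ((0 - 1 / 2) / lambda) with (- (1 / (2 * lambda))) by (field; lra).
replace (sinh (- (1 / (2 * lambda)))) with (- sinh (1 / (2 * lambda))).
- field; lra.
- unfold sinh; rewrite Ropp_involutive; field; lra.
Qed.

Lemma kernel_prim_1 (lambda : R) : 0 < lambda -> kernel_prim lambda 1 = - (1 / 2).
Proof.
intros Hl; assert (A := sinh_half_pos lambda Hl); unfold kernel_prim.
replace ((1 - 1 / 2) / lambda) with (1 / (2 * lambda)) by (field; lra).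
field; lra.
Qed.

Lemma is_derive_kernel_prim (lambda x : R) : 0 < lambda -> 0 <= x ->
  is_derive (kernel_prim lambda) x (kernel01 lambda x).
Proof.
intros Hl Hx; assert (A := sinh_half_pos lambda Hl).
unfold kernel_prim, kernel01; rewrite Rabs_pos_eq by exact Hx.
set (S := sinh (1 / (2 * lambda))) in *.
unfold sinh, cosh; auto_derive; [trivial|].
change ((x + - (1 / 2)) * / lambda) with ((x - 1 / 2) / lambda); field; lra.
Qed.

(** A coordinate of the vector field at a curve with speed [s] and velocity coordinate
    [w], after integration by parts. *)
Definition field_coord (lambda : R) (s w : R -> R) (u : R) : R :=
  1 / lambda ^ 2 * (kernel_amp_pos lambda * expint (1 / lambda) s w u
    + kernel_amp_neg lambda * expint (- (1 / lambda)) s w u).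

(** With [K] the primitive of the kernel and [x v] the arc-length ratio from [u] to
    [v], the derivative of [g * K x] is the sum of [g' * K x] and of the integrand of
    the convolution. Over the period starting at [u] the ratio runs through [0, 1],
    where the periodic kernel is smooth, and the boundary term
    [g u * (K 1 - K 0) = - g u] cancels the summand [g u] of the field. What is left
    involves the curve only through its derivative. *)
Lemma convolution_by_parts (lambda : R) (g s : R -> R) (u : R) :
  0 < lambda -> speed_data s (Derive g) -> (forall x, ex_derive g x) ->
  (forall x, g (x + 1) = g x) -> 0 < arc s 1 ->
  - (1 / lambda ^ 2) *
    (g u + RInt (fun v => Gker lambda (/ arc s 1 * arc s v - / arc s 1 * arc s u)
                          * (s v / arc s 1) * g v) 0 1)
  = field_coord lambda s (Derive g) u.
Proof.
intros Hl Hs Hg Hper HL.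
set (x := fun v => (arc s v - arc s u) / arc s 1).
assert (Dx : forall v, is_derive x v (s v / arc s 1)).
{ intros v; unfold x; auto_derive; [eexists; apply (is_derive_arc s _ Hs)|].
  replace (Derive (fun x : R => arc s x) v) with (s v)
    by (symmetry; apply is_derive_unique, (is_derive_arc s _ Hs)).
  unfold Rdiv; ring. }
pose (P := fun v => Derive g v * kernel_prim lambda (x v)).
assert (CP : forall v, continuous P v).
{ intros v; apply continuous_Rmult; [apply Hs|].
  apply (ex_derive_continuous (fun v => kernel_prim lambda (x v))).
  unfold kernel_prim, sinh; auto_derive; repeat split; eexists; apply Dx. }
assert (EP : RInt P u (u + 1) = kernel_amp_pos lambda * expint (1 / lambda) s (Derive g) u
  + kernel_amp_neg lambda * expint (- (1 / lambda)) s (Derive g) u).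
{ assert (CI := fun th => expint_integrand_continuous s _ Hs th u).
  unfold expint.
  change (RInt P u (u + 1) = plus
    (scal (kernel_amp_pos lambda) (RInt (fun v => Derive g v * exp (1 / lambda * x v)) u (u + 1)))
    (scal (kernel_amp_neg lambda)
      (RInt (fun v => Derive g v * exp (- (1 / lambda) * x v)) u (u + 1)))).
  rewrite <- !(RInt_scal (V := R_CompleteNormedModule)) by (apply ex_RInt_R, CI).
  rewrite <- (RInt_plus (V := R_CompleteNormedModule)).
  - apply RInt_ext; intros v _; unfold P; rewrite kernel_prim_exp by exact Hl.
    change (Derive g v * (kernel_amp_pos lambda * exp (1 / lambda * x v)
      + kernel_amp_neg lambda * exp (- (1 / lambda) * x v))
      = kernel_amp_pos lambda * (Derive g v * exp (1 / lambda * x v))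
        + kernel_amp_neg lambda * (Derive g v * exp (- (1 / lambda) * x v))); ring.
  - apply ex_RInt_R; intros t.
    apply (continuous_scal_r (kernel_amp_pos lambda) (fun v => Derive g v * exp (1 / lambda * x v))), CI.
  - apply ex_RInt_R; intros t.
    apply (continuous_scal_r (kernel_amp_neg lambda)
      (fun v => Derive g v * exp (- (1 / lambda) * x v))), CI. }
pose (Q := fun v => g v * ((s v / arc s 1) *
  - (cosh ((x v - 1 / 2) / lambda) / (2 * lambda * sinh (1 / (2 * lambda)))))).
assert (CQ : forall v, continuous Q v).
{ intros v; apply continuous_Rmult; [apply (ex_derive_continuous g), Hg|].
  apply continuous_Rmult.
  - apply (continuous_ext (fun v => / arc s 1 * s v)); [intros; apply Rmult_comm|].
    apply (continuous_scal_r (/ arc s 1) s), Hs.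
  - apply (ex_derive_continuous
      (fun v => - (cosh ((x v - 1 / 2) / lambda) / (2 * lambda * sinh (1 / (2 * lambda)))))).
    unfold cosh; auto_derive; repeat split; eexists; apply Dx. }
assert (I : is_RInt (fun v => plus (P v) (Q v)) u (u + 1) (- g u)).
{ evar_last.
  - apply (is_RInt_derive (V := R_CompleteNormedModule) (fun v => g v * kernel_prim lambda (x v))).
    + rewrite Rmin_left, Rmax_right by lra; intros v Hv.
      assert (Hx := arc_ratio s _ Hs u v HL Hv); fold (x v) in Hx.
      evar_last.
      * apply (is_derive_mult g (fun v => kernel_prim lambda (x v)) v (Derive g v)
          (s v / arc s 1 * kernel01 lambda (x v))).
        -- apply Derive_correct, Hg.
        -- apply (is_derive_comp (kernel_prim lambda) x v); [|apply Dx].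
           apply is_derive_kernel_prim; [exact Hl | apply Hx].
        -- exact Rmult_comm.
      * unfold kernel01; rewrite (Rabs_pos_eq (x v)) by apply Hx; reflexivity.
    + intros v _; apply (continuous_plus P Q); [apply CP | apply CQ].
  - cbv beta; rewrite Hper.
    replace (x (u + 1)) with 1
      by (unfold x; rewrite (arc_shift s _ Hs); field; lra).
    replace (x u) with 0 by (unfold x; field; lra).
    rewrite kernel_prim_0, kernel_prim_1 by exact Hl.
    change (g u * - (1 / 2) - g u * (1 / 2) = - g u); field. }
apply (is_RInt_unique (V := R_CompleteNormedModule)) in I.
rewrite (RInt_plus (V := R_CompleteNormedModule)) in I by (apply ex_RInt_R; assumption).
change (RInt P u (u + 1) + RInt Q u (u + 1) = - g u) in I.
assert (X : forall v, / arc s 1 * arc s v - / arc s 1 * arc s u = x v)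
  by (intros v; unfold x; field; lra).
assert (J : forall v, u < v < u + 1 ->
  Q v = Gker lambda (/ arc s 1 * arc s v - / arc s 1 * arc s u) * (s v / arc s 1) * g v).
{ intros v Hv.
  assert (Hx := arc_ratio s _ Hs u v HL ltac:(lra)); fold (x v) in Hx.
  rewrite X, Gker_unit_interval by exact Hx.
  unfold kernel01; rewrite Rabs_pos_eq by apply Hx; unfold Q; ring. }
rewrite (RInt_periodic _ u).
- rewrite <- (RInt_ext Q).
  + unfold field_coord; rewrite <- EP.
    replace (RInt P u (u + 1)) with (- (g u + RInt Q u (u + 1))) by lra.
    ring.
  + rewrite Rmin_left, Rmax_right by lra; exact J.
- intros v; rewrite Hper, (proj1 (proj2 (proj2 Hs))), (arc_shift s _ Hs).
  do 2 f_equal; unfold Gker; f_equal.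
  rewrite <- (frac_part_plus_1 (/ arc s 1 * arc s v - _)); f_equal; field; lra.
- apply (ex_RInt_ext Q); [|apply ex_RInt_R, CQ].
  rewrite Rmin_left, Rmax_right by lra; exact J.
Qed.

(** * The vector field on closed curves *)

Definition speed (g : R -> plane) (u : R) : R := enorm (vDerive g u).

Definition velocity (b : bool) (g : R -> plane) (u : R) : R := Derive (fun x => coord b (g x)) u.

Lemma curve_speed_data (b : bool) (g : C1S) : speed_data (speed g) (velocity b g).
Proof.
repeat split; intros u.
- apply (continuous_comp (vDerive g) enorm); [apply vDerive_continuous|].
  apply (filterlim_norm (vDerive g u)).
- apply (continuous_ext (fun u => coord b (vDerive g u))).
  + intros x; apply coord_vDerive.
  + apply continuous_coord, vDerive_continuous.
- unfold speed; rewrite vDerive_periodic by apply curve_C1; reflexivity.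
- unfold velocity; rewrite <- !coord_vDerive, vDerive_periodic by apply curve_C1; reflexivity.
- unfold velocity; rewrite <- coord_vDerive; apply coord_le_enorm.
Qed.

(** This identity is the only place where the convolution defining the field is used. *)
Lemma coord_Fvf (lambda : R) (b : bool) (g : C1S) (u : R) : 0 < lambda ->
  coord b (Fvf lambda g u) =
  if Req_EM_T (curve_length g) 0 then 0
  else field_coord lambda (speed g) (velocity b g) u.
Proof.
intros Hl; unfold Fvf; destruct (Req_EM_T (curve_length g) 0) as [H|H].
- destruct b; reflexivity.
- etransitivity; [|apply (convolution_by_parts lambda (fun x => coord b (g x)) (speed g) u Hl
    (curve_speed_data b g))].
  + destruct b; reflexivity.
  + intros x; apply ex_derive_coord, curve_C1.
  + intros x; rewrite (proj1 (curve_C1 g)); reflexivity.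
  + apply (arc_pos_of_neq_0 _ _ (curve_speed_data b g)), H.
Qed.

Definition field_coord_derive (lambda : R) (s w : R -> R) (u : R) : R :=
  1 / lambda ^ 2 *
  (kernel_amp_pos lambda * (w u * (exp (1 / lambda) - 1)
     - 1 / lambda * (s u / arc s 1) * expint (1 / lambda) s w u)
   + kernel_amp_neg lambda * (w u * (exp (- (1 / lambda)) - 1)
     - - (1 / lambda) * (s u / arc s 1) * expint (- (1 / lambda)) s w u)).

Definition field_bound (lambda : R) : R :=
  Rabs (1 / lambda ^ 2) * (Rabs (kernel_amp_pos lambda) * Cexp (1 / lambda)
    + Rabs (kernel_amp_neg lambda) * Cexp (- (1 / lambda))).

Lemma Cexp_pos (th : R) : 0 <= Cexp th.
Proof.
apply Rle_trans with (exp (Rabs th)); [apply Rlt_le, exp_pos | apply Cexp_bounds].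
Qed.

Lemma field_bound_nonneg (lambda : R) : 0 <= field_bound lambda.
Proof.
apply Rmult_le_pos; [apply Rabs_pos|].
apply Rplus_le_le_0_compat; apply Rmult_le_pos; try apply Rabs_pos; apply Cexp_pos.
Qed.

Lemma Rabs_combination_le (lambda x y M : R) :
  Rabs x <= Cexp (1 / lambda) * M -> Rabs y <= Cexp (- (1 / lambda)) * M ->
  Rabs (1 / lambda ^ 2 * (kernel_amp_pos lambda * x + kernel_amp_neg lambda * y))
  <= field_bound lambda * M.
Proof.
intros Hx Hy; unfold field_bound.
rewrite Rabs_mult, Rmult_assoc; apply Rmult_le_compat_l; [apply Rabs_pos|].
apply Rle_trans with (1 := Rabs_triang _ _); rewrite !Rabs_mult.
rewrite Rmult_plus_distr_r, !Rmult_assoc.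
apply Rplus_le_compat; apply Rmult_le_compat_l; try apply Rabs_pos; assumption.
Qed.

Lemma is_derive_field_coord (lambda : R) (s w : R -> R) (u : R) :
  speed_data s w -> 0 < arc s 1 ->
  is_derive (field_coord lambda s w) u (field_coord_derive lambda s w u).
Proof.
intros Hs HL; unfold field_coord, field_coord_derive.
apply (is_derive_scal (fun u => kernel_amp_pos lambda * expint (1 / lambda) s w u
    + kernel_amp_neg lambda * expint (- (1 / lambda)) s w u)).
apply (is_derive_plus (fun u => kernel_amp_pos lambda * expint (1 / lambda) s w u)
  (fun u => kernel_amp_neg lambda * expint (- (1 / lambda)) s w u));
  apply is_derive_scal, is_derive_expint; assumption.
Qed.

Lemma continuous_field_coord_derive (lambda : R) (s w : R -> R) (u : R) :
  speed_data s w -> 0 < arc s 1 -> continuous (field_coord_derive lambda s w) u.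
Proof.
intros Hs HL.
assert (T : forall k th, continuous (fun u => k * (w u * (exp th - 1)
     - th * (s u / arc s 1) * expint th s w u)) u).
{ intros k th.
  apply (continuous_scal_r k (fun u => w u * (exp th - 1)
     - th * (s u / arc s 1) * expint th s w u)).
  apply (continuous_minus (fun u => w u * (exp th - 1))
    (fun u => th * (s u / arc s 1) * expint th s w u)).
  - apply continuous_Rmult; [apply Hs | apply continuous_const].
  - apply continuous_Rmult.
    + apply (continuous_scal_r th (fun u => s u / arc s 1)).
      apply continuous_Rmult; [apply Hs | apply continuous_const].
    + apply (ex_derive_continuous (expint th s w)); eexists; apply is_derive_expint; assumption. }
apply (continuous_scal_r (1 / lambda ^ 2) (fun u =>
  kernel_amp_pos lambda * (w u * (exp (1 / lambda) - 1)
     - 1 / lambda * (s u / arc s 1) * expint (1 / lambda) s w u)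
   + kernel_amp_neg lambda * (w u * (exp (- (1 / lambda)) - 1)
     - - (1 / lambda) * (s u / arc s 1) * expint (- (1 / lambda)) s w u))).
apply (continuous_plus (fun u => kernel_amp_pos lambda * (w u * (exp (1 / lambda) - 1)
     - 1 / lambda * (s u / arc s 1) * expint (1 / lambda) s w u))
  (fun u => kernel_amp_neg lambda * (w u * (exp (- (1 / lambda)) - 1)
     - - (1 / lambda) * (s u / arc s 1) * expint (- (1 / lambda)) s w u))); apply T.
Qed.

Lemma expint_periodic (th : R) (s w : R -> R) (u : R) : speed_data s w ->
  expint th s w (u + 1) = expint th s w u.
Proof.
intros Hs; unfold expint.
assert (C := expint_integrand_continuous s w Hs th (u + 1)).
assert (E := RInt_comp_lin (V := R_CompleteNormedModule)
  (fun v => w v * exp (th * ((arc s v - arc s (u + 1)) / arc s 1))) 1 1 u (u + 1)).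
rewrite !Rmult_1_l in E; rewrite <- E by (apply ex_RInt_R, C).
apply RInt_ext; intros v _.
change (1 * (w (1 * v + 1) * exp (th * ((arc s (1 * v + 1) - arc s (u + 1)) / arc s 1)))
  = w v * exp (th * ((arc s v - arc s u) / arc s 1))).
rewrite !Rmult_1_l, !(arc_shift s w Hs), (proj1 (proj2 (proj2 (proj2 Hs)))).
do 4 f_equal; ring.
Qed.

Lemma Fvf_C1_periodic (lambda : R) (g : C1S) : 0 < lambda -> C1_periodic (Fvf lambda g).
Proof.
intros Hl; destruct (Req_EM_T (curve_length g) 0) as [H|H].
- replace (Fvf lambda g) with (fun _ : R => zero : plane); [apply C1_zero|].
  apply functional_extensionality; intros u; unfold Fvf.
  destruct (Req_EM_T (curve_length g) 0); [reflexivity | contradiction].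
- assert (E : forall b u, coord b (Fvf lambda g u)
    = field_coord lambda (speed g) (velocity b g) u).
  { intros b u; rewrite coord_Fvf by exact Hl.
    destruct (Req_EM_T (curve_length g) 0); [contradiction | reflexivity]. }
  assert (HL := arc_pos_of_neq_0 _ _ (curve_speed_data true g) H).
  assert (D : forall b u, is_derive (fun x => coord b (Fvf lambda g x)) u
    (field_coord_derive lambda (speed g) (velocity b g) u)).
  { intros b u; apply (is_derive_ext (field_coord lambda (speed g) (velocity b g))).
    - intros x; symmetry; apply E.
    - apply is_derive_field_coord; [apply curve_speed_data | exact HL]. }
  split; [|split].
  + intros u.
    assert (P : forall b, coord b (Fvf lambda g (u + 1)) = coord b (Fvf lambda g u)).
    { intros b; rewrite !E; unfold field_coord.
      rewrite !expint_periodic by apply curve_speed_data; reflexivity. }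
    generalize (P true) (P false); destruct (Fvf lambda g (u + 1)), (Fvf lambda g u); simpl.
    intros -> ->; reflexivity.
  + intros u; split; [eexists; apply (D true) | eexists; apply (D false)].
  + intros u.
    assert (C : forall b, continuous (fun x => coord b (vDerive (Fvf lambda g) x)) u).
    { intros b.
      apply (continuous_ext (field_coord_derive lambda (speed g) (velocity b g))).
      - intros x; rewrite coord_vDerive; symmetry; apply is_derive_unique, D.
      - apply continuous_field_coord_derive; [apply curve_speed_data | exact HL]. }
    apply continuous_pair_iff; split; [apply (C true) | apply (C false)].
Qed.

Definition field (lambda : R) (Hl : 0 < lambda) (g : C1S) : C1S :=
  mkC1S (Fvf lambda g) (Fvf_C1_periodic lambda g Hl).

Section Field.
Context (lambda : R) (Hl : 0 < lambda).

Lemma coord_field (b : bool) (g : C1S) (u : R) : 0 < curve_length g ->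
  coord b (field lambda Hl g u) = field_coord lambda (speed g) (velocity b g) u.
Proof.
intros HL; change (field lambda Hl g u) with (Fvf lambda g u); rewrite coord_Fvf by exact Hl.
destruct (Req_EM_T (curve_length g) 0); [lra | reflexivity].
Qed.

Lemma coord_vDerive_field (b : bool) (g : C1S) (u : R) : 0 < curve_length g ->
  coord b (vDerive (field lambda Hl g) u)
  = field_coord_derive lambda (speed g) (velocity b g) u.
Proof.
intros HL; rewrite coord_vDerive.
apply is_derive_unique, (is_derive_ext (field_coord lambda (speed g) (velocity b g))).
- intros x; symmetry; apply coord_field, HL.
- apply is_derive_field_coord; [apply curve_speed_data | exact HL].
Qed.

Lemma field_length_0 (g : C1S) : curve_length g = 0 -> field lambda Hl g = zero.
Proof.
intros H; apply C1S_ext; intros u.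
change (Fvf lambda g u = zero); unfold Fvf.
destruct (Req_EM_T (curve_length g) 0); [reflexivity | contradiction].
Qed.

Lemma curve_length_nonneg (g : C1S) : 0 <= curve_length g.
Proof.
destruct (Req_dec (curve_length g) 0) as [->|H]; [lra|].
apply Rlt_le, (arc_pos_of_neq_0 _ _ (curve_speed_data true g)), H.
Qed.

Lemma RInt_le_const (f : R -> R) (M : R) : (forall t, continuous f t) ->
  (forall t, f t <= M) -> RInt f 0 1 <= M.
Proof.
intros Hf HM.
replace M with (RInt (fun _ => M) 0 1).
- apply RInt_le; [lra | apply ex_RInt_R, Hf | apply ex_RInt_R; intros; apply continuous_const|].
  intros t _; apply HM.
- rewrite RInt_const; change ((1 - 0) * M = M); ring.
Qed.

Lemma curve_length_le_sup_speed (g : C1S) : curve_length g <= sup_norm (vDerive g).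
Proof.
apply RInt_le_const.
- apply (curve_speed_data true g).
- intros u; apply enorm_vDerive_le_sup_norm.
Qed.

Lemma Rabs_coord_field_le (b : bool) (g : C1S) (u : R) :
  Rabs (coord b (field lambda Hl g u)) <= field_bound lambda * curve_length g.
Proof.
destruct (Req_dec (curve_length g) 0) as [H|H].
- rewrite field_length_0, H, Rmult_0_r by exact H.
  apply Req_le; destruct b; apply Rabs_R0.
- assert (HL := arc_pos_of_neq_0 _ _ (curve_speed_data b g) H).
  rewrite coord_field by exact HL; apply Rabs_combination_le;
    apply Rle_trans with (1 := Rabs_expint_le _ _ (curve_speed_data b g) _ u HL).
  + apply Rmult_le_compat_r; [apply Rlt_le, HL | apply Cexp_bounds].
  + apply Rmult_le_compat_r; [apply Rlt_le, HL | apply Cexp_bounds].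
Qed.

(** Both terms of the derivative of [expint] carry a factor of size [speed g u], and the
    integral in the second one is of the size of the length that divides it. The bound is
    thus pointwise in [u]: the tangent vector at a point controls its own rate of
    change. *)
Lemma Rabs_coord_vDerive_field_le (b : bool) (g : C1S) (u : R) :
  Rabs (coord b (vDerive (field lambda Hl g) u)) <= field_bound lambda * enorm (vDerive g u).
Proof.
destruct (Req_dec (curve_length g) 0) as [H|H].
- rewrite field_length_0 by exact H.
  replace (vDerive (zero : C1S) u) with (zero : plane).
  + apply Rle_trans with 0; [apply Req_le; destruct b; apply Rabs_R0|].
    apply Rmult_le_pos; [apply field_bound_nonneg | apply norm_ge_0].
  + unfold vDerive; simpl; rewrite !Derive_const; reflexivity.
- assert (HL := arc_pos_of_neq_0 _ _ (curve_speed_data b g) H).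
  rewrite coord_vDerive_field by exact HL; apply Rabs_combination_le;
    apply (Rabs_derive_expint_le _ _ (curve_speed_data b g) _ u HL).
Qed.

Lemma C1_norm_field_le (g : C1S) :
  C1_norm (field lambda Hl g) <= 4 * field_bound lambda * sup_norm (vDerive g).
Proof.
assert (C := field_bound_nonneg lambda).
replace (4 * field_bound lambda * sup_norm (vDerive g))
  with (2 * (field_bound lambda * sup_norm (vDerive g))
        + 2 * (field_bound lambda * sup_norm (vDerive g))) by ring.
apply C1_norm_le_coord; intros b u.
- apply Rle_trans with (1 := Rabs_coord_field_le b g u).
  apply Rmult_le_compat_l; [exact C | apply curve_length_le_sup_speed].
- apply Rle_trans with (1 := Rabs_coord_vDerive_field_le b g u).
  apply Rmult_le_compat_l; [exact C | apply enorm_vDerive_le_sup_norm].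
Qed.

Lemma vDerive_minus (f g : C1S) (u : R) :
  vDerive (minus f g : C1S) u = minus (vDerive f u) (vDerive g u).
Proof.
assert (T := coord_vDerive_minus true f g u); assert (F := coord_vDerive_minus false f g u).
simpl in T, F; unfold vDerive, minus, plus, opp in *; simpl in *.
unfold prod_plus, prod_opp, plus, opp; simpl; f_equal; assumption.
Qed.

Lemma speed_distance (f g : C1S) (u : R) :
  Rabs (speed f u - speed g u) <= C1_norm (minus f g).
Proof.
apply Rle_trans with (enorm (vDerive (minus f g : C1S) u)).
- rewrite vDerive_minus; unfold speed.
  apply (norm_triangle_inv (vDerive f u) (vDerive g u)).
- apply Rle_trans with (1 := enorm_vDerive_le_sup_norm _ u), sup_norm_vDerive_le_C1_norm.
Qed.

Lemma velocity_distance (b : bool) (f g : C1S) (u : R) :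
  Rabs (velocity b f u - velocity b g u) <= C1_norm (minus f g).
Proof.
unfold velocity; rewrite <- !coord_vDerive, <- coord_vDerive_minus.
apply Rle_trans with (1 := coord_le_enorm _ _).
apply Rle_trans with (1 := enorm_vDerive_le_sup_norm _ u), sup_norm_vDerive_le_C1_norm.
Qed.

Lemma curve_length_distance (f g : C1S) :
  Rabs (curve_length f - curve_length g) <= C1_norm (minus f g).
Proof.
apply (Rabs_length_minus_le _ _ _ _ _ (curve_speed_data true f) (curve_speed_data true g)).
intros u; apply speed_distance.
Qed.

Lemma sup_speed_distance (f g : C1S) :
  Rabs (sup_norm (vDerive f) - sup_norm (vDerive g)) <= C1_norm (minus f g).
Proof.
assert (H : forall f g : C1S,
  sup_norm (vDerive f) <= sup_norm (vDerive g) + C1_norm (minus f g)).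
{ intros f1 g1; apply (sup_norm_lub _ (vDerive_continuous f1)); intros u _.
  assert (A := enorm_vDerive_le_sup_norm g1 u); assert (B := speed_distance f1 g1 u).
  apply Rabs_le_between in B; unfold speed in B; lra. }
assert (A := H f g); assert (B := H g f).
assert (E : C1_norm (minus g f) = C1_norm (minus f g))
  by apply (norm_minus_sym (V := C1S_NormedModule)).
rewrite E in B; apply Rabs_le; lra.
Qed.

(** The length enters as a denominator only through [speed f u / curve_length f], in
    the derivative of the field; the constant degenerates through this ratio alone, taken
    at only one of the two curves. *)
Lemma field_lipschitz (f g : C1S) : 0 < curve_length f -> 0 < curve_length g ->
  C1_norm (minus (field lambda Hl f) (field lambda Hl g))
  <= 4 * field_bound lambda * (1 + sup_norm (vDerive f) / curve_length f) * C1_norm (minus f g).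
Proof.
intros Hf Hg; set (D := C1_norm (minus f g)).
assert (HD : 0 <= D) by apply (norm_ge_0 (V := C1S_NormedModule)).
assert (HC := field_bound_nonneg lambda).
set (q := sup_norm (vDerive f) / curve_length f).
assert (Hs := fun u => enorm_vDerive_le_sup_norm f u).
assert (Hq : 0 <= q).
{ apply Rle_mult_inv_pos; [|exact Hf].
  apply Rle_trans with (2 := Hs 0), norm_ge_0. }
replace (4 * field_bound lambda * (1 + q) * D)
  with (2 * (field_bound lambda * ((1 + q) * D)) + 2 * (field_bound lambda * ((1 + q) * D))) by ring.
assert (T : forall th, Cexp th * D <= Cexp th * ((1 + q) * D)).
{ intros th; apply Rmult_le_compat_l; [apply Cexp_pos | nra]. }
apply C1_norm_le_coord; intros b u.
- rewrite coord_minus, !coord_field by assumption; unfold field_coord.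
  rewrite <- Rmult_minus_distr_l.
  match goal with |- Rabs (_ * (?a * ?x + ?b * ?y - (?a * ?x' + ?b * ?y'))) <= _ =>
    replace (a * x + b * y - (a * x' + b * y')) with (a * (x - x') + b * (y - y')) by ring end.
  assert (Q : forall th, Rabs (expint th (speed f) (velocity b f) u
      - expint th (speed g) (velocity b g) u) <= Cexp th * ((1 + q) * D)).
  { intros th; apply Rle_trans with (2 := T th).
    apply Rle_trans with (1 := expint_lipschitz _ _ _ _ D (curve_speed_data b f)
      (curve_speed_data b g) (speed_distance f g) (velocity_distance b f g) th u Hf Hg).
    apply Rmult_le_compat_r; [exact HD | apply Cexp_bounds]. }
  apply Rabs_combination_le; apply Q.
- rewrite coord_vDerive_minus, !coord_vDerive_field by assumption; unfold field_coord_derive.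
  rewrite <- Rmult_minus_distr_l.
  match goal with |- Rabs (_ * (?a * ?x + ?b * ?y - (?a * ?x' + ?b * ?y'))) <= _ =>
    replace (a * x + b * y - (a * x' + b * y')) with (a * (x - x') + b * (y - y')) by ring end.
  assert (Q : forall th, Cexp th * (1 + speed f u / arc (speed f) 1) * D
    <= Cexp th * ((1 + q) * D)).
  { intros th; rewrite Rmult_assoc; apply Rmult_le_compat_l; [apply Cexp_pos|].
    apply Rmult_le_compat_r; [exact HD|]; apply Rplus_le_compat_l.
    apply Rmult_le_compat_r; [apply Rlt_le, Rinv_0_lt_compat, Hf | apply Hs]. }
  apply Rabs_combination_le;
    (eapply Rle_trans; [|apply Q]);
    apply (derive_expint_lipschitz _ _ _ _ D (curve_speed_data b f)
      (curve_speed_data b g) (speed_distance f g) (velocity_distance b f g)); assumption.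
Qed.

End Field.

(** * A globally Lipschitz modification of the field *)

Lemma norm_minus_scal_le {V : NormedModule R_AbsRing} (a b : R) (x y : V) :
  norm (minus (scal a x) (scal b y)) <= Rabs a * norm (minus x y) + Rabs (a - b) * norm y.
Proof.
apply (norm_minus_trans_le _ (scal a y)).
- apply Rle_trans with (2 := norm_scal a (minus x y)), Req_le; f_equal.
  symmetry; apply (scal_minus_distr_l a x y).
- apply Rle_trans with (2 := norm_scal (minus a b) y), Req_le; f_equal.
  symmetry; apply (scal_minus_distr_r a b y).
Qed.

Lemma norm_minus_le {V : NormedModule R_AbsRing} (x y : V) :
  norm (minus x y) <= norm x + norm y.
Proof. apply Rle_trans with (1 := norm_triangle x (opp y)); rewrite norm_opp; lra. Qed.

Lemma Rmin_1_lipschitz (a b : R) : Rabs (Rmin 1 a - Rmin 1 b) <= Rabs (a - b).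
Proof.
unfold Rmin; destruct (Rle_dec 1 a), (Rle_dec 1 b); unfold Rabs; repeat destruct Rcase_abs; lra.
Qed.

(** For a constant curve the quotient is [0 / 0], that is [0], and the field vanishes. *)
Definition cutoff (m : R) (g : C1S) : R :=
  Rmin 1 (m * (curve_length g / sup_norm (vDerive g))).

Definition cut_field (lambda : R) (Hl : 0 < lambda) (m : R) (g : C1S) : C1S :=
  scal (cutoff m g) (field lambda Hl g).

Section CutField.
Context (lambda : R) (Hl : 0 < lambda).
Let C := 4 * field_bound lambda.

Lemma cut_constant_nonneg : 0 <= C.
Proof. assert (A := field_bound_nonneg lambda); unfold C; lra. Qed.

Lemma cut_field_length_0 (m : R) (g : C1S) :
  curve_length g = 0 -> cut_field lambda Hl m g = zero.
Proof.
intros H; unfold cut_field; rewrite field_length_0 by exact H.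
apply (scal_zero_r (V := C1S_ModuleSpace)).
Qed.

Lemma C1_norm_zero : C1_norm zero = 0.
Proof. apply (norm_zero (V := C1S_NormedModule)). Qed.

Lemma sup_speed_pos (g : C1S) : 0 < curve_length g -> 0 < sup_norm (vDerive g).
Proof. intros H; apply Rlt_le_trans with (1 := H), curve_length_le_sup_speed. Qed.

Lemma cutoff_bounds (m : R) (g : C1S) : 0 <= m ->
  0 <= cutoff m g <= 1 /\ cutoff m g <= m * (curve_length g / sup_norm (vDerive g)).
Proof.
intros Hm; unfold cutoff; split; [split|].
- apply Rmin_glb; [lra|]; apply Rmult_le_pos; [exact Hm|].
  destruct (curve_length_nonneg g) as [HL|HL].
  + apply Rle_mult_inv_pos; [lra | apply sup_speed_pos, HL].
  + rewrite <- HL; unfold Rdiv; rewrite Rmult_0_l; apply Rle_refl.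
- apply Rmin_l.
- apply Rmin_r.
Qed.

(** The field is bounded by the maximal speed; after the cutoff it is bounded by the
    length, hence small near constant curves even if the speed is concentrated. *)
Lemma C1_norm_cut_field_le (m : R) (g : C1S) : 0 <= m ->
  C1_norm (cut_field lambda Hl m g) <= C * m * curve_length g.
Proof.
intros Hm; destruct (curve_length_nonneg g) as [HL|HL].
- destruct (cutoff_bounds m g Hm) as [[H0 _] Hb].
  apply Rle_trans with (1 := C1_norm_scal _ _); rewrite Rabs_pos_eq by exact H0.
  assert (HM := sup_speed_pos g HL).
  apply Rle_trans with (m * (curve_length g / sup_norm (vDerive g)) * (C * sup_norm (vDerive g))).
  + apply Rmult_le_compat; [exact H0 | apply (norm_ge_0 (V := C1S_NormedModule)) | exact Hb|].
    apply C1_norm_field_le.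
  + apply Req_le; field; lra.
- rewrite cut_field_length_0, C1_norm_zero, <- HL by (symmetry; exact HL); lra.
Qed.

Lemma Rabs_coord_vDerive_cut_field_le (m : R) (b : bool) (g : C1S) (u : R) : 0 <= m ->
  Rabs (coord b (vDerive (cut_field lambda Hl m g) u)) <= field_bound lambda * speed g u.
Proof.
intros Hm.
apply Rle_trans with (2 := Rabs_coord_vDerive_field_le lambda Hl b g u).
assert (E : coord b (vDerive (cut_field lambda Hl m g) u)
  = cutoff m g * coord b (vDerive (field lambda Hl g) u)).
{ change (curve (cut_field lambda Hl m g))
    with (fun x => scal (cutoff m g) (field lambda Hl g x)).
  rewrite vDerive_scal; destruct b; reflexivity. }
rewrite E, Rabs_mult.
destruct (cutoff_bounds m g Hm) as [H _].
rewrite (Rabs_pos_eq (cutoff m g)) by lra.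
assert (P := Rabs_pos (coord b (vDerive (field lambda Hl g) u))); nra.
Qed.

(** Write the difference as
    [cutoff f * (F f - F g) + (cutoff f - cutoff g) * F g]. The Lipschitz constant
    [C * (1 + Mf / Lf)] of the first part is absorbed by [cutoff f <= m * Lf / Mf]; in the
    second part the bound [C * Mg] of [F g] absorbs the denominators of the quotients
    [L / M], which differ by at most [2 * D / Mg]. If one of the lengths vanishes, the two
    norms add up to at most a multiple of the difference of the lengths. *)
Lemma cut_field_lipschitz (m : R) (f g : C1S) : 0 <= m ->
  C1_norm (minus (cut_field lambda Hl m f) (cut_field lambda Hl m g))
  <= C * (1 + 3 * m) * C1_norm (minus f g).
Proof.
intros Hm; set (D := C1_norm (minus f g)).
assert (HD : 0 <= D) by apply (norm_ge_0 (V := C1S_NormedModule)).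
assert (HC := cut_constant_nonneg).
assert (HLD := curve_length_distance f g); fold D in HLD; apply Rabs_le_between in HLD.
assert (HCD : 0 <= C * D) by nra.
assert (HCmD : 0 <= C * m * D) by (apply Rmult_le_pos; [apply Rmult_le_pos|]; assumption).
assert (Z : curve_length f = 0 \/ curve_length g = 0 ->
  C1_norm (minus (cut_field lambda Hl m f) (cut_field lambda Hl m g)) <= C * (1 + 3 * m) * D).
{ intros H.
  apply Rle_trans with (1 := norm_minus_le (V := C1S_NormedModule) _ _).
  assert (A := C1_norm_cut_field_le m f Hm); assert (B := C1_norm_cut_field_le m g Hm).
  apply Rle_trans with (1 := Rplus_le_compat _ _ _ _ A B).
  assert (Cm : 0 <= C * m) by nra.
  assert (curve_length f + curve_length g <= D) by (destruct H; lra).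
  nra. }
destruct (curve_length_nonneg f) as [Hf|Hf]; [|apply Z; auto].
destruct (curve_length_nonneg g) as [Hg|Hg]; [|apply Z; auto].
clear Z.
destruct (cutoff_bounds m f Hm) as [[H0 H1] Hb].
assert (HMf := sup_speed_pos f Hf); assert (HMg := sup_speed_pos g Hg).
assert (HLf := curve_length_le_sup_speed f).
assert (HM := sup_speed_distance f g); fold D in HM.
assert (HLD' := curve_length_distance f g); fold D in HLD'.
assert (E1 := field_lipschitz lambda Hl f g Hf Hg); fold C D in E1.
assert (E2 := C1_norm_field_le lambda Hl g); fold C in E2.
set (Mf := sup_norm (vDerive f)) in *; set (Mg := sup_norm (vDerive g)) in *.
set (Lf := curve_length f) in *; set (Lg := curve_length g) in *.
apply Rle_trans with (1 := norm_minus_scal_le (V := C1S_NormedModule) _ _ _ _).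
rewrite Rabs_pos_eq by exact H0.
assert (P1 : cutoff m f * C1_norm (minus (field lambda Hl f) (field lambda Hl g))
  <= C * (1 + m) * D).
{ apply Rle_trans with (cutoff m f * (C * (1 + Mf / Lf) * D)).
  - apply Rmult_le_compat_l; assumption.
  - assert (cutoff m f * (Mf / Lf) <= m).
    { apply Rle_trans with (m * (Lf / Mf) * (Mf / Lf)).
      - apply Rmult_le_compat_r; [apply Rle_mult_inv_pos; lra | exact Hb].
      - apply Req_le; field; lra. }
    nra. }
assert (P2 : Rabs (cutoff m f - cutoff m g) * C1_norm (field lambda Hl g) <= C * (2 * m) * D).
{ apply Rle_trans with (m * Rabs (Lf / Mf - Lg / Mg) * (C * Mg)).
  - apply Rmult_le_compat;
      [apply Rabs_pos | apply (norm_ge_0 (V := C1S_NormedModule)) | | exact E2].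
    unfold cutoff; apply Rle_trans with (1 := Rmin_1_lipschitz _ _).
    rewrite <- Rmult_minus_distr_l, Rabs_mult, (Rabs_pos_eq m) by exact Hm; apply Rle_refl.
  - replace (m * Rabs (Lf / Mf - Lg / Mg) * (C * Mg))
      with (C * m * (Mg * Rabs (Lf / Mf - Lg / Mg))) by ring.
    replace (C * (2 * m) * D) with (C * m * (D + D)) by ring.
    apply Rmult_le_compat_l; [apply Rmult_le_pos; assumption|].
    rewrite <- (Rabs_pos_eq Mg) at 1 by lra; rewrite <- Rabs_mult.
    replace (Mg * (Lf / Mf - Lg / Mg))
      with (- (Lf / Mf * (Mf - Mg)) + (Lf - Lg)) by (field; lra).
    apply Rle_trans with (1 := Rabs_triang _ _); apply Rplus_le_compat; [|exact HLD'].
    rewrite Rabs_Ropp, Rabs_mult.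
    assert (0 <= Lf / Mf <= 1).
    { split; [apply Rle_mult_inv_pos; lra|].
      apply Rmult_le_reg_r with Mf; [exact HMf|]; field_simplify; lra. }
    rewrite (Rabs_pos_eq (Lf / Mf)) by lra.
    assert (P := Rabs_pos (Mf - Mg)); nra. }
apply Rle_trans with (1 := Rplus_le_compat _ _ _ _ P1 P2); lra.
Qed.

Lemma cut_field_time_lipschitz (m1 m2 : R) (g : C1S) :
  C1_norm (minus (cut_field lambda Hl m1 g) (cut_field lambda Hl m2 g))
  <= C * curve_length g * Rabs (m1 - m2).
Proof.
destruct (curve_length_nonneg g) as [HL|HL].
- assert (HM := sup_speed_pos g HL).
  unfold cut_field.
  apply Rle_trans with (1 := norm_minus_scal_le (V := C1S_NormedModule) _ _ _ _).
  rewrite (norm_minus_self (V := C1S_NormedModule)), Rmult_0_r, Rplus_0_l.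
  apply Rle_trans with (Rabs (m1 - m2) * (curve_length g / sup_norm (vDerive g))
    * (C * sup_norm (vDerive g))).
  + apply Rmult_le_compat;
      [apply Rabs_pos | apply (norm_ge_0 (V := C1S_NormedModule)) | | apply C1_norm_field_le].
    unfold cutoff; apply Rle_trans with (1 := Rmin_1_lipschitz _ _).
    rewrite <- Rmult_minus_distr_r, Rabs_mult.
    rewrite (Rabs_pos_eq (curve_length g / _)) by (apply Rle_mult_inv_pos; lra).
    apply Rle_refl.
  + apply Req_le; field; lra.
- rewrite !cut_field_length_0, <- HL by (symmetry; exact HL).
  apply Rle_trans with (1 := Req_le _ _ (norm_minus_self (V := C1S_NormedModule) zero)); lra.
Qed.

Lemma cut_field_inactive (m : R) (g : C1S) :
  (0 < curve_length g -> sup_norm (vDerive g) <= m * curve_length g) ->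
  cut_field lambda Hl m g = field lambda Hl g.
Proof.
intros H; destruct (curve_length_nonneg g) as [HL|HL].
- assert (HM := sup_speed_pos g HL).
  unfold cut_field; replace (cutoff m g) with 1; [apply (scal_one (V := C1S_ModuleSpace))|].
  unfold cutoff; rewrite Rmin_left; [reflexivity|]; specialize (H HL).
  apply Rmult_le_reg_r with (1 := HM).
  replace (m * (curve_length g / sup_norm (vDerive g)) * sup_norm (vDerive g))
    with (m * curve_length g) by (field; lra); lra.
- rewrite cut_field_length_0, field_length_0 by (symmetry; exact HL); reflexivity.
Qed.

Lemma cut_field_continuous (m : R -> R) (X : R -> C1S) (t : R) :
  (forall t, 0 <= m t) -> (forall t, continuous m t) -> (forall t, continuous X t) ->
  continuous (fun s => cut_field lambda Hl (m s) (X s)) t.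
Proof.
intros Hm Cm CX.
apply (proj2 (filterlim_norm_iff (V := C1S_NormedModule) (locally t) _ _)); intros eps He.
pose (h := fun s => C * (1 + 3 * m s) * norm (minus (X s) (X t))
  + C * curve_length (X t) * Rabs (m s - m t)).
assert (Ch : continuous h t).
{ assert (CN : continuous (fun s => norm (minus (X s) (X t))) t).
  { apply (continuous_norm (V := C1S_NormedModule)),
      (continuous_minus (V := C1S_NormedModule) X (fun _ => X t)); [apply CX | apply continuous_const]. }
  assert (CR : continuous (fun s => Rabs (m s - m t)) t).
  { apply (continuous_norm (V := R_NormedModule)), (continuous_minus m (fun _ => m t));
      [apply Cm | apply continuous_const]. }
  apply (continuous_plus (fun s => C * (1 + 3 * m s) * norm (minus (X s) (X t)))
    (fun s => C * curve_length (X t) * Rabs (m s - m t))).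
  - apply continuous_Rmult; [|exact CN].
    apply (continuous_scal_r C (fun s => 1 + 3 * m s)).
    apply (continuous_plus (fun _ => 1) (fun s => 3 * m s)); [apply continuous_const|].
    apply (continuous_scal_r 3 m), Cm.
  - apply (continuous_scal_r (C * curve_length (X t)) (fun s => Rabs (m s - m t))), CR. }
assert (H0 : h t = 0).
{ unfold h; rewrite (norm_minus_self (V := C1S_NormedModule)), Rminus_diag, Rabs_R0; ring. }
generalize (proj1 (filterlim_locally h (h t)) Ch (mkposreal eps He)); apply filter_imp.
intros s Hs; rewrite H0 in Hs.
apply Rle_lt_trans with (h s).
- apply (norm_minus_trans_le (V := C1S_NormedModule) _ (cut_field lambda Hl (m s) (X t))).
  + apply cut_field_lipschitz, Hm.
  + apply cut_field_time_lipschitz.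
- apply Rle_lt_trans with (1 := Rle_abs _).
  change (Rabs (h s - 0) < eps) in Hs; rewrite Rminus_0_r in Hs; exact Hs.
Qed.

End CutField.

(** * Growth of the speed along solutions *)

Lemma is_derive_bounded_linear {V : NormedModule R_AbsRing} (l : V -> R) (X : R -> V)
    (t : R) (dX : V) :
  is_linear (V := R_NormedModule) l -> is_derive X t dX ->
  is_derive (fun s => l (X s)) t (l dX).
Proof.
intros Hl HX; unfold is_derive.
apply filterdiff_ext_lin with (fun y => l (scal y dX)).
- apply (filterdiff_comp X l (fun y => scal y dX) l); [exact HX|].
  apply filterdiff_linear, Hl.
- intros y; apply (linear_scal l Hl y).
Qed.

Lemma is_linear_velocity (b : bool) (u : R) :
  is_linear (U := C1S_NormedModule) (V := R_NormedModule) (fun g : C1S => coord b (vDerive g u)).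
Proof.
split.
- intros f g; change (curve (plus f g)) with (fun x => plus (f x) (g x)).
  rewrite vDerive_plus by apply curve_C1; destruct b; reflexivity.
- intros k f; change (curve (scal k f)) with (fun x => scal k (f x)).
  rewrite vDerive_scal; destruct b; reflexivity.
- exists 1; split; [lra|]; intros f; rewrite Rmult_1_l.
  apply Rle_trans with (1 := coord_le_enorm b _).
  apply Rle_trans with (1 := enorm_vDerive_le_sup_norm f u), sup_norm_vDerive_le_C1_norm.
Qed.

Lemma enorm_sqr (p : plane) : enorm p * enorm p = coord true p ^ 2 + coord false p ^ 2.
Proof.
destruct p as [x y]; change (enorm (x, y)) with (sqrt (Rabs x ^ 2 + Rabs y ^ 2)).
rewrite !pow2_abs; apply (sqrt_sqrt (x ^ 2 + y ^ 2)).
assert (A := pow2_ge_0 x); assert (B := pow2_ge_0 y); lra.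
Qed.

Lemma is_derive_sum_sqr (p q : R -> R) (t p' q' : R) :
  is_derive p t p' -> is_derive q t q' ->
  is_derive (fun s => p s ^ 2 + q s ^ 2) t (2 * (p t * p' + q t * q')).
Proof.
intros Hp Hq; auto_derive; [repeat split; eexists; eassumption|].
replace (Derive (fun x : R => p x) t) with p' by (symmetry; apply is_derive_unique, Hp).
replace (Derive (fun x : R => q x) t) with q' by (symmetry; apply is_derive_unique, Hq).
ring.
Qed.

(** This is [gronwall] for the reversed function [r |-> g (t - r)]. *)
Lemma gronwall_reversed (g dg : R -> R) (c T : R) :
  (forall t, is_derive g t (dg t)) ->
  (forall t, 0 <= t <= T -> - dg t <= c * g t) ->
  forall t, 0 <= t <= T -> g 0 <= g t * exp (c * t).
Proof.
intros Hd Hle t Ht.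
assert (G := gronwall (fun r => g (t - r)) (fun r => - dg (t - r)) c t).
cbv beta in G; rewrite Rminus_0_r in G.
rewrite <- (Rminus_diag t) at 1; apply G; [| |lra].
- intros r; evar_last.
  + apply (is_derive_comp g (fun r => t - r) r (dg (t - r)) (-1)); [apply Hd|].
    auto_derive; [trivial | ring].
  + change (-1 * dg (t - r) = - dg (t - r)); ring.
- intros r Hr; apply Hle; lra.
Qed.

(** For fixed [u] the velocity vector [vDerive (X t) u] is a curve in the plane whose
    derivative is at most [2 c] times its own length; its squared length therefore grows
    and decays at most like [exp (4 c t)]. *)
Lemma speed_growth (X dX : R -> C1S) (c : R) :
  0 <= c -> C1_ray X dX ->
  (forall t b u, 0 <= t -> Rabs (coord b (vDerive (dX t) u)) <= c * speed (X t) u) ->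
  forall t u, 0 <= t ->
    speed (X t) u <= speed (X 0) u * exp (2 * c * t) /\
    speed (X 0) u <= speed (X t) u * exp (2 * c * t).
Proof.
intros Hc HX Hle t u Ht.
destruct (C1_ray_extension X dX HX) as (Y & dY & EY & DY & _).
pose (p := fun b s => coord b (vDerive (Y s) u)).
pose (q := fun b s => coord b (vDerive (dY s) u)).
assert (Dp : forall b s, is_derive (p b) s (q b s)).
{ intros b s; apply (is_derive_bounded_linear _ Y s (dY s) (is_linear_velocity b u)), DY. }
pose (g := fun s => p true s ^ 2 + p false s ^ 2).
pose (dg := fun s => 2 * (p true s * q true s + p false s * q false s)).
assert (Dg : forall s, is_derive g s (dg s)).
{ intros s; apply is_derive_sum_sqr; apply Dp. }
assert (Eg : forall s, 0 <= s -> g s = speed (X s) u * speed (X s) u).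
{ intros s Hs; unfold g, p; rewrite (proj1 (EY s Hs)); symmetry; apply enorm_sqr. }
assert (Hg : forall s, 0 <= s -> Rabs (dg s) <= 4 * c * g s).
{ intros s Hs.
  assert (Q : forall b, Rabs (p b s * q b s) <= c * g s).
  { intros b; rewrite Rabs_mult, Eg by exact Hs.
    unfold p, q; destruct (EY s Hs) as [-> ->].
    apply Rle_trans with (speed (X s) u * (c * speed (X s) u)); [|lra].
    apply Rmult_le_compat; try apply Rabs_pos; [apply coord_le_enorm | apply Hle, Hs]. }
  unfold dg; rewrite Rabs_mult, (Rabs_pos_eq 2) by lra.
  assert (R := Rabs_triang (p true s * q true s) (p false s * q false s)).
  assert (A := Q true); assert (B := Q false); lra. }
assert (G1 := gronwall g dg (4 * c) t Dg
  (fun s Hs => Rle_trans _ _ _ (Rle_abs _) (Hg s (proj1 Hs))) t ltac:(lra)).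
assert (G2 := gronwall_reversed g dg (4 * c) t Dg
  (fun s Hs => Rle_trans _ _ _ (Rle_trans _ _ _ (Rle_abs _) (Req_le _ _ (Rabs_Ropp _)))
     (Hg s (proj1 Hs))) t ltac:(lra)).
rewrite !Eg in G1, G2 by lra.
replace (exp (4 * c * t)) with (exp (2 * c * t) * exp (2 * c * t)) in G1, G2
  by (rewrite <- exp_plus; f_equal; ring).
assert (P : forall r, 0 <= speed (X r) u) by (intros r; apply norm_ge_0).
assert (E := exp_pos (2 * c * t)).
split; apply Rsqr_incr_0; unfold Rsqr; try apply P;
  try (apply Rmult_le_pos; [apply P | lra]); lra.
Qed.

Definition growth (lambda : R) : R := 2 * field_bound lambda.

(** The largest ratio of maximal speed to length compatible with [speed_growth]: both
    numerator and denominator change by a factor of at most [exp (growth lambda * t)]. *)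
Definition cutoff_level (lambda : R) (X0 : C1S) (t : R) : R :=
  sup_norm (vDerive X0) / curve_length X0 * exp (2 * growth lambda * t).

Lemma cutoff_level_nonneg (lambda : R) (X0 : C1S) (t : R) : 0 <= cutoff_level lambda X0 t.
Proof.
apply Rmult_le_pos; [|apply Rlt_le, exp_pos].
apply Rmult_le_pos; [apply sup_norm_nonneg, vDerive_continuous|].
destruct (curve_length_nonneg X0) as [H|H].
- apply Rlt_le, Rinv_0_lt_compat, H.
- rewrite <- H, Rinv_0; lra.
Qed.

Lemma cutoff_level_increasing (lambda : R) (X0 : C1S) (s t : R) :
  s <= t -> cutoff_level lambda X0 s <= cutoff_level lambda X0 t.
Proof.
intros Hst; assert (C := field_bound_nonneg lambda).
apply Rmult_le_compat_l.
- assert (A := cutoff_level_nonneg lambda X0 0); unfold cutoff_level in A.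
  rewrite Rmult_0_r, exp_0, Rmult_1_r in A; exact A.
- apply exp_le_exp; unfold growth; nra.
Qed.

Lemma cutoff_level_continuous (lambda : R) (X0 : C1S) (t : R) :
  continuous (cutoff_level lambda X0) t.
Proof.
apply (ex_derive_continuous (cutoff_level lambda X0)).
unfold cutoff_level; auto_derive; trivial.
Qed.

(** If [X0] is constant, then [X t] has length [0] and the positivity hypothesis fails, so
    the value of [cutoff_level] is only used for nonconstant [X0]. *)
Lemma speed_growth_field (lambda : R) (X0 : C1S) (X dX : R -> C1S) :
  C1_ray X dX -> X 0 = X0 ->
  (forall t b u, 0 <= t ->
     Rabs (coord b (vDerive (dX t) u)) <= field_bound lambda * speed (X t) u) ->
  forall t, 0 <= t -> 0 < curve_length (X t) ->
    sup_norm (vDerive (X t)) <= cutoff_level lambda X0 t * curve_length (X t).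
Proof.
intros HX H0 Hle t Ht HLt.
assert (G := speed_growth X dX _ (field_bound_nonneg lambda) HX Hle).
rewrite H0 in G; fold (growth lambda) in G.
set (E := exp (growth lambda * t)) in *.
assert (HE : 0 < E) by apply exp_pos.
assert (L : forall f g : C1S, (forall u, speed f u <= speed g u * E) ->
  curve_length f <= curve_length g * E).
{ intros f g H; unfold curve_length.
  replace (RInt (fun u => enorm (vDerive g u)) 0 1 * E)
    with (RInt (fun u => scal E (speed g u)) 0 1).
  - apply RInt_le; [lra | | |].
    + apply ex_RInt_R, (curve_speed_data true f).
    + apply ex_RInt_R; intros x; apply (continuous_scal_r E (speed g)), (curve_speed_data true g).
    + intros u _; apply Rle_trans with (1 := H u), Req_le, Rmult_comm.
  - rewrite (RInt_scal (V := R_CompleteNormedModule) (speed g))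
      by (apply ex_RInt_R, (curve_speed_data true g)).
    apply Rmult_comm. }
assert (L1 := L (X t) X0 (fun u => proj1 (G t u Ht))).
assert (L2 := L X0 (X t) (fun u => proj2 (G t u Ht))).
assert (M : sup_norm (vDerive (X t)) <= sup_norm (vDerive X0) * E).
{ apply (sup_norm_lub _ (vDerive_continuous (X t))); intros u _.
  apply Rle_trans with (1 := proj1 (G t u Ht)).
  apply Rmult_le_compat_r; [lra | apply enorm_vDerive_le_sup_norm]. }
unfold cutoff_level.
replace (exp (2 * growth lambda * t)) with (E * E)
  by (unfold E; rewrite <- exp_plus; f_equal; ring).
destruct (curve_length_nonneg X0) as [HL|HL].
- apply Rle_trans with (1 := M).
  apply Rle_trans with (sup_norm (vDerive X0) / curve_length X0 * E * curve_length X0).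
  + apply Req_le; field; lra.
  + assert (A : 0 <= sup_norm (vDerive X0) / curve_length X0 * E).
    { apply Rmult_le_pos; [|lra]; apply Rle_mult_inv_pos; [|exact HL].
      apply Rlt_le, sup_speed_pos, HL. }
    apply Rle_trans with (sup_norm (vDerive X0) / curve_length X0 * E * (curve_length (X t) * E)).
    * apply Rmult_le_compat_l; assumption.
    * apply Req_le; ring.
- rewrite <- HL in L1; lra.
Qed.

(** * Existence and uniqueness *)

Theorem lemma6p1 :
  forall lambda : R, 0 < lambda ->
  forall X0 : C1S,
  exists X : R -> C1S,
    is_solution lambda X0 X /\
    forall Z : R -> C1S, is_solution lambda X0 Z ->
      forall t, 0 <= t -> Z t = X t.
Proof.
intros lambda Hl X0.
pose (m := cutoff_level lambda X0).
pose (f := fun t g => cut_field lambda Hl (m t) g).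
assert (Hm := cutoff_level_nonneg lambda X0 : forall t, 0 <= m t).
assert (Hcont : forall X : R -> C1S, (forall t, continuous X t) ->
  forall t, continuous (fun s => f s (X s)) t).
{ intros X CX t; apply cut_field_continuous; [exact Hm | | exact CX].
  apply cutoff_level_continuous. }
assert (HC := field_bound_nonneg lambda).
assert (Hlip : forall T, exists K, 0 < K /\ forall t (x y : C1S), t <= T ->
  norm (minus (f t x) (f t y)) <= K * norm (minus x y)).
{ intros T; exists (4 * field_bound lambda * (1 + 3 * m T) + 1); split.
  - specialize (Hm T); nra.
  - intros t x y Ht.
    apply Rle_trans with (1 := cut_field_lipschitz lambda Hl (m t) x y (Hm t)).
    apply Rmult_le_compat_r; [apply (norm_ge_0 (V := C1S_NormedModule))|].
    assert (A := cutoff_level_increasing lambda X0 t T Ht); fold m in A; nra. }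
destruct (picard_lindelof_global (V := C1S_CompleteNormedModule) f X0 Hcont Hlip)
  as (X & E0 & CX & DX).
assert (RX : C1_ray X (fun t => f t (X t))).
{ intros t Ht; split.
  - apply is_derive_is_derive_ray, DX, Ht.
  - apply continuous_continuous_ray, Hcont, CX. }
assert (EX : forall t, 0 <= t -> f t (X t) = field lambda Hl (X t)).
{ intros t Ht; apply cut_field_inactive.
  apply (speed_growth_field lambda X0 X _ RX E0); [|exact Ht].
  intros s b u Hs; apply Rabs_coord_vDerive_cut_field_le, Hm. }
exists X; split.
- split; [exact E0|].
  exists (fun t => f t (X t)); split; [exact RX|].
  intros t Ht u; rewrite EX by exact Ht; reflexivity.
- intros Z (E0' & dZ & RZ & HZ) t Ht.
  assert (EdZ : forall s, 0 <= s -> dZ s = field lambda Hl (Z s)).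
  { intros s Hs; apply C1S_ext, HZ, Hs. }
  assert (EZ : forall s, 0 <= s -> f s (Z s) = field lambda Hl (Z s)).
  { intros s Hs; apply cut_field_inactive.
    apply (speed_growth_field lambda X0 Z dZ RZ E0'); [|exact Hs].
    intros r b u Hr; rewrite EdZ by exact Hr; apply Rabs_coord_vDerive_field_le. }
  destruct (Hlip t) as (K & _ & HK).
  apply (C1_ray_unique (V := C1S_CompleteNormedModule) Z X dZ (fun t => f t (X t)) K t RZ RX);
    [rewrite E0, E0'; reflexivity | | lra].
  intros s Hs; rewrite EdZ, <- EZ by lra; apply HK; lra.
Qed.
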